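(* Let $\mathbf V$ be a pseudovariety of semigroups with $\mathbf V\nsubseteq \mathbf{LI}$. Let $\sigma$ be a highly computable implicit signature and let $\sigma^*$ be a highly computable $\sigma$-maximal signature such that: (1) for every finite alphabet $A$ and every word $u\in A^+$ there is a computable $\sigma$-term $\mathrm e_u\in T_A^{\sigma}$ such that $\mathbf S\models \mathrm e_u=u^\omega$; (2) for every finite alphabet $A$, every integer $k\ge 1$ and every $\sigma^*$-term $w\in T_A^{\sigma^*}$, it is possible to compute a (possibly empty) $\sigma^*$-term $\tau_w$ such that $\mathbf S\models w=(\mathtt i_k w)\tau_w$. If $\mathbf V$ is pointlike $\sigma$-reducible, then $\mathbf V*\mathbf D$ is pointlike $\sigma$-reducible.
   Context: All alphabets are finite. $\mathbf S$ is the pseudovariety of all finite semigroups, $\mathbf{LI}=\llbracket x^\omega yx^\omega=x^\omega\rrbracket$, $\mathbf D=\llbracket yx^\omega=x^\omega\rrbracket$, and, for $k\ge1$, $\mathbf D_k=\llbracket yx_1\cdots x_k=x_1\cdots x_k\rrbracket$, $\mathbf K_k=\llbracket x_1\cdots x_ky=x_1\cdots x_k\rrbracket$. $\mathbf V*\mathbf W$ is the pseudovariety generated by all semidirect products $S*T$ with $S\in\mathbf V$, $T\in\mathbf W$, where $T$ acts on the left of $S$ by endomorphisms and $(s,t)(s',t')=(s\cdot{}^{t}s',tt')$. $\overline\Omega_A\mathbf V$ is the pro-$\mathbf V$ semigroup freely generated by $A$; its elements are identified with $A$-ary implicit operations on $\mathbf V$. $p_{\mathbf V}:\overline\Omega_A\mathbf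 S\to\overline\Omega_A\mathbf V$ is the continuous homomorphism fixing the generators. For $\pi,\rho\in\overline\Omega_A\mathbf S$, $\mathbf V\models\pi=\rho$ means $p_{\mathbf V}\pi=p_{\mathbf V}\rho$ (extended to $(\overline\Omega_A\mathbf S)^1$ by $p_{\mathbf V}1=1$). In a compact semigroup $s^\omega$ is the unique idempotent in the closed subsemigroup generated by $s$. An implicit signature is a set of finitary implicit operations over finite semigroups containing the multiplication. It is highly computable if it is recursively enumerable and consists of computable operations. For an implicit signature $\sigma$, $T_A^\sigma$ (whose elements are the $\sigma$-terms) is the free $\sigma$-algebra on $A$ in the variety of $\sigma$-algebras defined by $x(yz)=(xy)z$; the empty $\sigma$-term is also allowed and identified with the empty word. $\Omega_A^\sigma\mathbf S$ is the $\sigma$-subsemigroup of $\overline\Omega_A\mathbf S$ generated by $A$, i.e. the image of $T_A^\sigma$ under the evaluation homomorphism fixing $A$; $\sigma$-terms are identified with their values in $\overline\Omega_A\mathbf S$ when writing $\mathbf S\models\cdot=\cdot$. For $\pi\in\overline\Omega_A\mathbf S$, $\mathtt i_k\pi$ and $\mathtt t_k\pi$ are the shortest words (of length at most $k$) such that $\mathbf K_k\models\pi=\mathtt i_k\pi$ and $\mathbf D_k\models\pi=\mathtt t_k\pi$; for words these are the longest prefix and longest suffix of length at most $k$. Let $B_k=\{w\in A^*:|w|\le k\}\times A$ and let $\beta'_A:\overline\Omega_A\mathbf S\to\overline\Omega_{B_k}\mathbf S$ be the unique continuous function with $\beta'_A(a_1\cdots a_n)=\prod_{i=1}^n(\mathtt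 t_k(a_1\cdots a_{i-1}),a_i)$ for $a_1,\dots,a_n\in A$, $n\ge 1$. An implicit signature $\sigma'$ is $(\sigma,\mathbf D_k)$-expressible if (i) $\beta'_A(\Omega_A^{\sigma'}\mathbf S)\subseteq\Omega_{B_k}^{\sigma}\mathbf S$ for every alphabet $A$, and (ii) there is an algorithm that computes, from an alphabet $A$ and $z\in T_A^{\sigma'}$, a $\sigma$-term $t\in T_{B_k}^\sigma$ with $\mathbf S\models\beta'_Az=t$. A $(\sigma,\mathbf D_k)$-expressible signature $\sigma'$ is $\sigma$-maximal if $\Omega_A^{\sigma''}\mathbf S\subseteq\Omega_A^{\sigma'}\mathbf S$ for every $(\sigma,\mathbf D_k)$-expressible signature $\sigma''$ and every alphabet $A$; here $\sigma^*$ is required to be $(\sigma,\mathbf D_k)$-expressible and $\sigma$-maximal for every $k\ge1$. Reducibility. Let $\Sigma$ be a finite set of equations over a finite alphabet $X$, $S$ a finite $A$-generated semigroup, $\delta:\overline\Omega_A\mathbf S\to S$ the continuous homomorphism respecting the choice of generators (extended by $\delta 1=1$), and $\varphi:X\to S^1$ a mapping. A mapping $\eta:X\to(\overline\Omega_A\mathbf S)^1$ is a $\mathbf V$-solution of $\Sigma$ with respect to $(\varphi,\delta)$ if $\delta\eta=\varphi$ and $\mathbf V\models\overline\eta u=\overline\eta v$ for all $(u=v)\in\Sigma$, where $\overline\eta$ is the natural extension of $\eta$. It is a $(\mathbf V,\sigma)$-solution if moreover $\eta X\subseteq(\Omega_A^\sigma\mathbf S)^1$. $\mathbf V$ is $\sigma$-reducible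 relatively to $\Sigma$ if, for every such pair $(\varphi,\delta)$, the existence of a $\mathbf V$-solution of $\Sigma$ with respect to $(\varphi,\delta)$ entails the existence of a $(\mathbf V,\sigma)$-solution of $\Sigma$ with respect to the same pair. $\mathbf V$ is pointlike $\sigma$-reducible if it is $\sigma$-reducible relatively to every system of equations of the form $x_1=x_2=\cdots=x_m$ with $m\ge2$. *)

(* Defs.v *)
From HB Require Import structures.
From mathcomp Require Import all_boot.
From mathcomp Require Import boolp classical_sets topology.

Set Implicit Arguments.
Unset Strict Implicit.
Unset Printing Implicit Defensive.

Import Algebra.
Local Open Scope classical_set_scope.
Local Open Scope group_scope.

(** * Finite semigroups *)

#[short(type="finSemigroupType")]
HB.structure Definition FinSemigroup := {G of Semigroup G & Finite G}.

(* The finite semigroups with carrier in [Set]; up to isomorphism, these are all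
   the finite semigroups, and their type is small enough to be a domain of
   [set].  The empty semigroup is allowed; it belongs to every
   pseudovariety. *)
Record finSemigroup := FinSg {
  fsg_sort : Set;
  fsg_class : FinSemigroup.axioms_ fsg_sort
}.

Coercion fsg_struct (S : finSemigroup) : finSemigroupType :=
  @FinSemigroup.Pack (fsg_sort S) (fsg_class S).

Notation finsg T := (@FinSg T (FinSemigroup.class T)).

Lemma unit_mulA : associative (fun _ _ : unit => tt).
Proof. by []. Qed.

HB.instance Definition _ := isSemigroup.Build unit unit_mulA.

Definition is_hom (S T : magmaType) (h : S -> T) : Prop :=
  forall x y, h (x * y) = h x * h y.

Definition dirprod (S T : finSemigroup) : Set := (fsg_sort S * fsg_sort T)%type.

Section DirectProduct.
Variables S T : finSemigroup.

HB.instance Definition _ := Finite.copy (dirprod S T) (S * T)%type.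

Definition dirprod_mul (p q : dirprod S T) : dirprod S T :=
  ((p.1 : S) * q.1, (p.2 : T) * q.2).

Lemma dirprod_mulA : associative dirprod_mul.
Proof. by move=> p q r; rewrite /dirprod_mul /= !mulgA. Qed.

HB.instance Definition _ := isSemigroup.Build (dirprod S T) dirprod_mulA.
End DirectProduct.

(* A left action of T on S by endomorphisms. *)
Record endo_action (S T : semigroupType) := EndoAction {
  act :> T -> S -> S;
  actM : forall t t' s, act (t * t') s = act t (act t' s);
  act_hom : forall t, is_hom (act t)
}.

Definition semidirect (S T : finSemigroup) (a : endo_action S T) : Set :=
  (fsg_sort S * fsg_sort T)%type.

Section SemidirectProduct.
Variables (S T : finSemigroup) (a : endo_action S T).

HB.instance Definition _ := Finite.copy (semidirect a) (S * T)%type.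

Definition semidirect_mul (p q : semidirect a) : semidirect a :=
  ((p.1 : S) * a p.2 q.1, (p.2 : T) * q.2).

Lemma semidirect_mulA : associative semidirect_mul.
Proof.
by move=> p q r; rewrite /semidirect_mul /= act_hom actM !mulgA.
Qed.

HB.instance Definition _ := isSemigroup.Build (semidirect a) semidirect_mulA.
End SemidirectProduct.

(** * The monoid S^1 *)

(* The new identity [None] is adjoined even if S is a monoid. *)

Definition adj1 (S : Type) : Type := option S.

HB.instance Definition _ (S : choiceType) := Choice.on (adj1 S).

Section AdjoinOne.
Variable S : semigroupType.

Definition adj1_mul (x y : adj1 S) : adj1 S :=
  match x, y with
  | Some s, Some t => Some (s * t)
  | None, _ => y
  | _, None => x
  end.

Lemma adj1_mulA : associative adj1_mul.
Proof. by move=> [x|] [y|] [z|] //=; rewrite mulgA. Qed.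

Lemma adj1_1mul : left_id None adj1_mul.
Proof. by case. Qed.

Lemma adj1_mul1 : right_id None adj1_mul.
Proof. by case. Qed.

HB.instance Definition _ :=
  isMonoid.Build (adj1 S) adj1_mulA adj1_1mul adj1_mul1.
End AdjoinOne.

Definition some1 (S : semigroupType) (s : S) : adj1 S := Some s.

Definition ext1 (S T : Type) (f : S -> T) (x : adj1 S) : adj1 T := omap f x.

(* The value in S^1 of a word over A, given the images in S of the letters. *)
Definition subst (A : Type) (S : semigroupType) (g : A -> S) (w : seq A) :
  adj1 S := \prod_(a <- w) some1 (g a).

Definition generates (A : Type) (S : semigroupType) (g : A -> S) : Prop :=
  forall s, exists w : seq A, subst g w = some1 s.

(** * Pseudovarieties *)

Record pseudovariety (V : set finSemigroup) : Prop := Pseudovariety {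
  pv_unit : V (finsg unit);
  pv_prod : forall S T : finSemigroup, V S -> V T -> V (finsg (dirprod S T));
  pv_sub : forall (S T : finSemigroup) (h : T -> S),
    is_hom h -> injective h -> V S -> V T;
  pv_quot : forall (S T : finSemigroup) (h : S -> T),
    is_hom h -> (forall t, exists s, h s = t) -> V S -> V T
}.

(* In a finite (discrete) semigroup, e = x^omega. *)
Definition omega_fin (S : finSemigroup) (x e : S) : Prop :=
  e * e = e /\ exists n, some1 e = some1 x ^+ n.+1.

Definition pvLI : set finSemigroup := fun S =>
  forall x y e : S, omega_fin x e -> e * y * e = e.

Definition pvD : set finSemigroup := fun S =>
  forall x y e : S, omega_fin x e -> y * e = e.

Definition pvKk (k : nat) : set finSemigroup := fun S =>
  forall (y : S) (x : 'I_k -> S),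
    \prod_(i < k) some1 (x i) * some1 y = \prod_(i < k) some1 (x i).

Definition pv_generated (C : set finSemigroup) : set finSemigroup :=
  fun R => forall U, pseudovariety U -> C `<=` U -> U R.

Definition pv_sd (V W : set finSemigroup) : set finSemigroup :=
  pv_generated (fun R => exists (S T : finSemigroup) (a : endo_action S T),
    [/\ V S, W T & R = finsg (semidirect a)]).

(** * Implicit operations *)

(* A-ary implicit operations on V: the elements of the pro-V semigroup freely
   generated by A. *)
Record iop (V : set finSemigroup) (A : Type) := Iop {
  iop_val :> forall S : finSemigroup, V S -> (A -> S) -> S;
  iop_nat : forall (S T : finSemigroup) (VS : V S) (VT : V T) (h : S -> T),
    is_hom h -> forall g : A -> S, h (iop_val VS g) = iop_val VT (h \o g)
}.

Lemma iop_eq V A (p q : iop V A) :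
  (forall S (VS : V S) (g : A -> S), p S VS g = q S VS g) -> p = q.
Proof.
case: p q => [p pn] [q qn] /= E.
have Epq : p = q.
  refine (functional_extensionality_dep _) => S.
  refine (functional_extensionality_dep _) => VS.
  refine (functional_extensionality_dep _) => g.
  exact: E.
by case: q / Epq qn E => qn _; congr Iop; apply: Prop_irrelevance.
Qed.

HB.instance Definition _ V A := gen_eqMixin (iop V A).
HB.instance Definition _ V A := gen_choiceMixin (iop V A).

Section ImplicitOperations.
Variables (V : set finSemigroup) (A : Type).

Program Definition iop_mul (p q : iop V A) : iop V A :=
  @Iop V A (fun S VS g => p S VS g * q S VS g) _.
Next Obligation.
by move=> p q S T VS VT h hM g /=; rewrite hM !(iop_nat _ VS VT hM).
Qed.

Lemma iop_mulA : associative iop_mul.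
Proof. by move=> p q r; apply: iop_eq => S VS g /=; rewrite mulgA. Qed.

HB.instance Definition _ := isSemigroup.Build (iop V A) iop_mulA.

Program Definition gen (a : A) : iop V A := @Iop V A (fun S VS g => g a) _.
Next Obligation. by []. Qed.

(* The topology of pointwise convergence, finite semigroups being discrete. *)
Definition iop_subbase : set (set (iop V A)) := fun U =>
  exists (S : finSemigroup) (VS : V S) (g : A -> S) (s : S),
    U = [set p : iop V A | p S VS g = s].

HB.instance Definition _ :=
  isSubBaseTopological.Build (iop V A) iop_subbase id.

End ImplicitOperations.

Arguments gen {V A} a.

Notation pvS := ([set: finSemigroup]).
Notation Omega A := (iop pvS A).

(* The element of (Omega A)^1 represented by a word. *)
Definition word (V : set finSemigroup) (A : Type) (w : seq A) :
  adj1 (iop V A) := subst gen w.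

Arguments word {V A} w.

Program Definition proj_pv (V : set finSemigroup) (A : Type)
  (p : Omega A) : iop V A := @Iop V A (fun S _ g => p S I g) _.
Next Obligation. by move=> V A p S T VS VT h hM g /=; apply: iop_nat. Qed.

Definition models (V : set finSemigroup) (A : Type)
    (p q : adj1 (Omega A)) : Prop :=
  ext1 (@proj_pv V A) p = ext1 (@proj_pv V A) q.

(* e = p^omega: e is the idempotent of the closed subsemigroup generated by p. *)
Definition is_omega (A : Type) (p e : Omega A) : Prop :=
  e * e = e /\
  closure [set q : Omega A | exists n, some1 q = some1 p ^+ n.+1] e.

Program Definition iop_comp (A : Type) (n : nat) (p : Omega 'I_n)
  (q : 'I_n -> Omega A) : Omega A :=
  @Iop pvS A (fun S VS g => p S VS (fun i => q i S VS g)) _.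
Next Obligation.
move=> A n p q S T VS VT h hM g /=; rewrite (iop_nat _ VS VT hM); congr (p T VT _).
by apply: funext => i /=; apply: iop_nat.
Qed.

(* The continuous homomorphism from Omega A to S extending g. *)
Definition is_delta (A : Type) (S : finSemigroup) (g : A -> S)
    (delta : Omega A -> S) : Prop :=
  [/\ forall s, open [set p | delta p = s], is_hom delta
    & forall a, delta (gen a) = g a].

(** * Prefixes, suffixes, and the maps beta'_A *)

Definition is_ik (k : nat) (A : Type) (p : adj1 (Omega A)) (w : seq A) : Prop :=
  [/\ size w <= k, models (pvKk k) p (word w)
    & forall w' : seq A, models (pvKk k) p (word w') -> size w <= size w'].

Lemma size_suffix (k : nat) (A : Type) (w : seq A) :
  size (drop (size w - k) w) <= k.
Proof. by rewrite size_drop leq_subCl. Qed.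

(* t_k w, for a word w *)
Definition tk (k : nat) (A : Type) (w : seq A) : k.-bseq A :=
  Bseq (size_suffix k w).

Definition Bk (k : nat) (A : Type) : Type := (k.-bseq A * A)%type.

(* The letters (t_k (q a_1 .. a_(i-1)), a_i), for w = a_1 .. a_n. *)
Fixpoint beta_word (k : nat) (A : Type) (q w : seq A) : seq (Bk k A) :=
  if w is a :: w' then (tk k q, a) :: beta_word k (rcons q a) w' else [::].

Definition is_beta (k : nat) (A : Type)
    (b : Omega A -> Omega (Bk k A)) : Prop :=
  continuous b /\
  forall (w : seq A) (p : Omega A), word w = some1 p ->
    some1 (b p) = word (beta_word k [::] w).

Local Close Scope group_scope.

(** * Recursive functions *)

(* Programs for the mu-recursive partial functions on tuples of naturals. *)
Inductive murec : Type :=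
| MZero
| MSucc
| MProj of nat
| MComp (k : nat) of murec & ('I_k -> murec)
| MPrec of murec & murec
| MMin of murec.

(* [computes f v y]: the program f halts on the input v with output y. *)
Fixpoint computes (f : murec) (v : seq nat) (y : nat) : Prop :=
  match f with
  | MZero => y = 0
  | MSucc => exists x v', v = x :: v' /\ y = x.+1
  | MProj i => i < size v /\ y = nth 0 v i
  | MComp k g h => exists z : 'I_k -> nat,
      (forall i, computes (h i) v (z i)) /\
      computes g [seq z i | i <- enum 'I_k] y
  | MPrec g h => exists n v' (z : nat -> nat),
      [/\ v = n :: v', y = z n, computes g v' (z 0)
        & forall i, i < n -> computes h [:: i, z i & v'] (z i.+1)]
  | MMin g => computes g (y :: v) 0 /\
      forall m, m < y -> exists r, computes g (m :: v) r.+1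
  end.

(** * Implicit signatures and their terms *)

Definition operation : Type := {n : nat & Omega 'I_n}.

Definition opmul : operation :=
  existT _ 2 (gen (ord0 : 'I_2) * gen (ord_max : 'I_2))%g.

Definition implicit_signature (sg : set operation) : Prop := sg opmul.

(* Omega_A^sigma S *)
Inductive Omega_sig (sg : set operation) (A : Type) : set (Omega A) :=
| Omega_sig_gen a : Omega_sig sg (gen a)
| Omega_sig_op n (p : Omega 'I_n) (q : 'I_n -> Omega A) :
    sg (existT _ n p) -> (forall i, Omega_sig sg (q i)) ->
    Omega_sig sg (iop_comp p q).

Arguments Omega_sig sg A _ : clear implicits.

(* An enumeration (possibly with repetitions) of the operations of a signature:
   the indices serve as names for the operations in algorithms. *)
Definition numbering : Type := nat -> operation.

Definition arity (nu : numbering) (i : nat) : nat := tag (nu i).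

(* sigma-terms, written with the names of the operations.  No quotient by
   associativity is taken: these are representatives of the elements of
   T_A^sigma, as handled by an algorithm, and [eval] identifies terms that are
   equal up to associativity. *)
Inductive term (nu : numbering) (A : Type) : Type :=
| Var of A
| App (i : nat) of ('I_(arity nu i) -> term nu A).

Fixpoint eval (nu : numbering) (A : Type) (t : term nu A) : Omega A :=
  match t with
  | Var a => gen a
  | App i ts => iop_comp (tagged (nu i)) (fun j => eval (ts j))
  end.

Definition code_seq : seq nat -> nat := CodeSeq.code.

Fixpoint code_term (nu : numbering) (A : Type) (c : A -> nat) (t : term nu A) :
    nat :=
  match t with
  | Var a => code_seq [:: 0; c a]
  | App i ts => code_seq
      [:: 1, i & [seq code_term c (ts j) | j <- enum 'I_(arity nu i)]]
  end.

Definition code_term1 (nu : numbering) (A : Type) (c : A -> nat)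
    (t : option (term nu A)) : nat :=
  if t is Some t' then code_term c t' else code_seq [::].

Definition eval1 (nu : numbering) (A : Type) (t : option (term nu A)) :
  adj1 (Omega A) := omap (@eval nu A) t.

(* In algorithms the alphabet with n letters is 'I_n, given by n. *)
Definition code_letter (n : nat) (a : 'I_n) : nat := a.

Definition code_word (n : nat) (w : seq 'I_n) : nat :=
  code_seq [seq code_letter a | a <- w].

Definition code_Bk (k n : nat) (b : Bk k 'I_n) : nat :=
  code_seq [:: code_word b.1; code_letter b.2].

(* The elements of a finite semigroup are named by their positions in [enum S],
   and the semigroup is given by its size and its multiplication table. *)
Definition code_elt (S : finSemigroup) (s : S) : nat := enum_rank s.

Definition code_table (S : finSemigroup) : nat :=
  code_seq [seq code_elt (x * y)%g | x <- enum S, y <- enum S].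

(* sg is recursively enumerable and consists of computable operations, nu being
   the enumeration.  The operations nu i are computable uniformly in i, i.e.
   programs for them can be effectively listed. *)
Definition highly_computable (sg : set operation) (nu : numbering) : Prop :=
  [/\ implicit_signature sg,
      range nu = sg,
      exists f : murec, forall i, computes f [:: i] (arity nu i)
    & exists f : murec,
        forall i (S : finSemigroup) (g : 'I_(arity nu i) -> S),
          computes f
            [:: i; #|S|; code_table S;
                code_seq [seq code_elt (g j) | j <- enum 'I_(arity nu i)]]
            (code_elt (tagged (nu i) S I g))].

Definition expressible (sg : set operation) (nu : numbering) (k : nat)
    (sg' : set operation) (nu' : numbering) : Prop :=
  [/\ implicit_signature sg',
      range nu' = sg',
      forall (A : finType) (b : Omega A -> Omega (Bk k A)), is_beta b ->
        b @` Omega_sig sg' A `<=` Omega_sig sg (Bk k A)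
    & exists f : murec, forall n (z : term nu' 'I_n),
        exists t : term nu (Bk k 'I_n),
          computes f [:: n; code_term (@code_letter n) z]
            (code_term (@code_Bk k n) t) /\
          forall b : Omega 'I_n -> Omega (Bk k 'I_n), is_beta b ->
            b (eval z) = eval t].

Definition maximal_expressible (sg : set operation) (nu : numbering) (k : nat)
    (sg' : set operation) (nu' : numbering) : Prop :=
  expressible sg nu k sg' nu' /\
  forall (sg'' : set operation) (nu'' : numbering),
    expressible sg nu k sg'' nu'' ->
    forall A : finType, Omega_sig sg'' A `<=` Omega_sig sg' A.

Definition sigma_maximal (sg : set operation) (nu : numbering)
    (sg' : set operation) (nu' : numbering) : Prop :=
  forall k, 1 <= k -> maximal_expressible sg nu k sg' nu'.

Definition computable_omega_words (nu : numbering) : Prop :=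
  exists f : murec, forall n (u : seq 'I_n) (p : Omega 'I_n),
    word u = some1 p ->
    exists e : term nu 'I_n,
      computes f [:: n; code_word u] (code_term (@code_letter n) e) /\
      is_omega p (eval e).

Definition computable_tails (nu : numbering) : Prop :=
  exists f : murec, forall n k (w : term nu 'I_n), 1 <= k ->
    exists tau : option (term nu 'I_n),
      computes f [:: n; k; code_term (@code_letter n) w]
        (code_term1 (@code_letter n) tau) /\
      forall u : seq 'I_n, is_ik k (some1 (eval w)) u ->
        some1 (eval w) = (word u * eval1 tau)%g.

(** * Reducibility *)

Definition is_solution (V : set finSemigroup) (X A : finType)
    (S : finSemigroup) (Sigma : seq (seq X * seq X)) (phi : X -> adj1 S)
    (delta : Omega A -> S) (eta : X -> adj1 (Omega A)) : Prop :=
  (forall x, ext1 delta (eta x) = phi x) /\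
  forall u v, (u, v) \in Sigma ->
    models V (\prod_(x <- u) eta x)%g (\prod_(x <- v) eta x)%g.

Definition is_sig_solution (sg : set operation) (V : set finSemigroup)
    (X A : finType) (S : finSemigroup) (Sigma : seq (seq X * seq X))
    (phi : X -> adj1 S) (delta : Omega A -> S) (eta : X -> adj1 (Omega A)) :
    Prop :=
  is_solution V Sigma phi delta eta /\
  forall x p, eta x = some1 p -> Omega_sig sg A p.

Definition reducible (sg : set operation) (V : set finSemigroup)
    (X : finType) (Sigma : seq (seq X * seq X)) : Prop :=
  forall (A : finType) (S : finSemigroup) (g : A -> S)
    (delta : Omega A -> S) (phi : X -> adj1 S),
    generates g -> is_delta g delta ->
    (exists eta, is_solution V Sigma phi delta eta) ->
    exists eta, is_sig_solution sg V Sigma phi delta eta.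

(* x = s_1 = ... = s_m, as the equations between consecutive variables *)
Definition pointlike_system (X : Type) (x : X) (s : seq X) :
  seq (seq X * seq X) := pairmap (fun y z => ([:: y], [:: z])) x s.

Definition pointlike_reducible (sg : set operation)
    (V : set finSemigroup) : Prop :=
  forall (X : finType) (x : X) (s : seq X),
    uniq (x :: s) -> 1 <= size s -> reducible sg V (pointlike_system x s).

(* Main.v *)
Require Import Defs.
From HB Require Import structures.
From mathcomp Require Import all_boot.
From mathcomp Require Import boolp classical_sets topology.

Set Implicit Arguments.
Unset Strict Implicit.
Unset Printing Implicit Defensive.

Import Algebra.
Local Open Scope classical_set_scope.
Local Open Scope group_scope.

(** Fix a map [g] from the alphabet [A] to the finite semigroup [S], and
    k > |S|.  Write u^w for the idempotent generated by u.

    From V * D to V.  Reading next to each letter of a word the k letters (at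
    most) that precede it turns the word into a word over the larger alphabet of
    pairs (window, letter).  This relabelling is what evaluation in a semidirect
    product of a power of a member of V by the free semigroup of D_(k+1)
    computes, so it extends to implicit operations ([beta]), and an identity
    p = q that holds in V * D gives V |= beta p = beta q, together with equality
    of the last k letters of p and q ([beta_sat]).

    From V back to V * D.  A word q of length k has two nonempty prefixes with
    the same value in S; the longer one, cut at position [cut q] when chosen as
    short as possible, is a prefix x such that x and x u have the same value
    for some nonempty u.  Hence inserting u^w at the cut does not change values
    in S, and u^w is given by a sigma-term.  As the cut is the earliest
    possible one, the cuts of the successive windows of a long word never move
    to the left ([cut_shift]).  The substitution [theta] replaces each pair
    (q, a) by the letters between the cut of q and the cut of the next window,
    surrounded by the two idempotents inserted there.  Up to a bounded prefix
    and suffix, theta (beta p) then has in S the value of p ([theta_value]).  On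
    the other hand, in a semidirect product of S0 in V by T0 in D an idempotent
    has a T0-component that forgets everything to its left.  Let r
    be a path in the graph of windows, and let theta r be preceded by the
    idempotent of its source.  The value of this product is then determined by
    the ends of r and by its value in S0 under an assignment of letters that
    does not depend on r ([path_op]).  So V |= r = r' gives an identity of V * D
    between theta r and theta r', for paths with the same ends ([theta_sat]).

    Now let the operations p_y be equal over V * D.  The operations beta p_y are
    equal over V.  Reducibility of V is applied to them, with a finite semigroup
    that records the value of theta in S and, through a Brandt semigroup, the
    ends of a path.  It gives sigma-operations r_y, and the theta r_y, completed
    by the missing prefix and suffix, solve the original system.

    The prefix and the suffix must be the same for all y.  The suffix is, since
    D is contained in V * D.  For the prefix, V is not contained in LI: the
    pair formed by the kth letter of a word and its window occurs exactly once
    in the relabelled word, and mapping it to e y e <> e, and every other pair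
    to the idempotent e, detects it ([prefix_detect]).  Operations whose last k
    letters number less than k are words, and are sigma-operations already. *)

(** * Values of words *)

Section Subst.
Variables (A : Type) (G : semigroupType) (g : A -> G).

Lemma subst_cons a w : subst g (a :: w) = some1 (g a) * subst g w.
Proof. exact: big_cons. Qed.

Lemma subst_nil : subst g [::] = None.
Proof. exact: big_nil. Qed.

Lemma subst_cat u v : subst g (u ++ v) = subst g u * subst g v.
Proof. by rewrite /subst big_cat. Qed.

Lemma subst_rcons w a : subst g (rcons w a) = subst g w * some1 (g a).
Proof. by rewrite -cats1 subst_cat subst_cons subst_nil mulg1. Qed.

Lemma subst_some a w : exists s, subst g (a :: w) = some1 s.
Proof. by rewrite subst_cons; case: (subst g w) => [s|]; eexists. Qed.
End Subst.

Lemma eq_subst A (G : semigroupType) (g h : A -> G) : g =1 h ->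
  subst g =1 subst h.
Proof. by move=> gh w; have -> : g = h by apply: funext. Qed.

Lemma some1M (G : semigroupType) (x y : G) : some1 (x * y) = some1 x * some1 y.
Proof. by []. Qed.

Lemma some1_inj (G : semigroupType) : injective (@some1 G).
Proof. by move=> x y []. Qed.

Lemma ext1M (G H : semigroupType) (h : G -> H) : is_hom h ->
  {morph @ext1 G H h : x y / x * y}.
Proof. by move=> hM [x|] [y|] //=; congr Some; apply: hM. Qed.

Lemma ext1_subst A (G H : semigroupType) (h : G -> H) (g : A -> G) w :
  is_hom h -> ext1 h (subst g w) = subst (h \o g) w.
Proof.
move=> hM; elim: w => [|a w IH]; first by rewrite !subst_nil.
by rewrite !subst_cons ext1M // IH.
Qed.

Lemma subst_map (A B : Type) (G : semigroupType) (f : A -> B) (g : B -> G) u :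
  subst g (map f u) = subst (g \o f) u.
Proof. exact: big_map. Qed.

Lemma adj1_stable (G : semigroupType) (x y : adj1 G) :
  x * y = x -> forall n, x * y ^+ n = x.
Proof.
by move=> xy; elim=> [|n IH]; rewrite ?expg0 ?mulg1 // expgS mulgA xy.
Qed.

Lemma subst_absorb (A : eqType) (G : semigroupType) (g : A -> G) (x : adj1 G)
    (e : G) s :
  x * some1 e = x -> (forall b, b \in s -> g b = e) -> x * subst g s = x.
Proof.
move=> xe; elim: s => [|b s IH] gs; first by rewrite subst_nil mulg1.
rewrite subst_cons mulgA gs ?mem_head // xe IH // => c cs.
by apply: gs; rewrite inE cs orbT.
Qed.

Lemma subst_absorb_l (A : eqType) (G : semigroupType) (g : A -> G) (x : adj1 G)
    (e : G) s :
  some1 e * x = x -> (forall b, b \in s -> g b = e) -> subst g s * x = x.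
Proof.
move=> ex; elim: s => [|b s IH] gs; first by rewrite subst_nil mul1g.
rewrite subst_cons -mulgA IH ?gs ?mem_head // => c cs.
by apply: gs; rewrite inE cs orbT.
Qed.

(** * Values of implicit operations in finite semigroups *)

HB.instance Definition _ (G H : finSemigroupType) := Finite.on (G * H)%type.
HB.instance Definition _ (I : finType) (G : finSemigroupType) :=
  Finite.on {ffun I -> G}.

Lemma hom_fst (G H : semigroupType) : is_hom (@fst G H).
Proof. by []. Qed.

Lemma hom_snd (G H : semigroupType) : is_hom (@snd G H).
Proof. by []. Qed.

Lemma hom_comp (G H K : semigroupType) (h : G -> H) (h' : H -> K) :
  is_hom h -> is_hom h' -> is_hom (h' \o h).
Proof. by move=> hM h'M x y; rewrite /= hM h'M. Qed.

(** Pseudovarieties contain finite semigroups carried by a [Set], whereas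
    words, windows and finite functions live in larger types.  Every finite
    type is therefore copied to an initial segment of [nat]. *)
Definition small_sort (G : finType) : Set := {i : nat | i < #|G|}.

Section SmallSort.
Variable G : finType.

Definition to_small (x : G) : small_sort G :=
  exist (fun i => is_true (i < #|G|)) (enum_rank x : nat)
    (ltn_ord (enum_rank x)).
Definition of_small (i : small_sort G) : G := enum_val (Ordinal (svalP i)).

Lemma to_smallK : cancel to_small of_small.
Proof.
by move=> x; rewrite -[RHS]enum_rankK; congr enum_val; apply: val_inj.
Qed.

Lemma of_smallK : cancel of_small to_small.
Proof. by move=> i; apply: val_inj; rewrite /= /of_small enum_valK. Qed.

Lemma to_small_inj : injective to_small. Proof. exact: can_inj to_smallK. Qed.
Lemma of_small_inj : injective of_small. Proof. exact: can_inj of_smallK. Qed.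

HB.instance Definition _ := Finite.copy (small_sort G) (can_type of_smallK).
End SmallSort.

Arguments to_small {G} x.
Arguments of_small {G} i.

Section Small.
Variable G : finSemigroupType.

Definition small_mul (x y : small_sort G) := to_small (of_small x * of_small y).

Lemma small_mulA : associative small_mul.
Proof. by move=> x y z; rewrite /small_mul !to_smallK mulgA. Qed.

HB.instance Definition _ := isSemigroup.Build (small_sort G) small_mulA.

Definition small : finSemigroup := finsg (small_sort G).

Lemma of_small_hom : @is_hom small G of_small.
Proof. by move=> x y; rewrite /mul /= /small_mul to_smallK. Qed.

Lemma to_small_hom : @is_hom G small to_small.
Proof. by move=> x y; rewrite /mul /= /small_mul !to_smallK. Qed.
End Small.

(** The value of an implicit operation in a finite semigroup of any
    universe, computed in its small copy. *)
Definition ev A (p : Omega A) (G : finSemigroupType) (g : A -> G) : G :=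
  of_small (p (small G) I (to_small \o g)).

Lemma evE A (p : Omega A) (S : finSemigroup) (VS : pvS S) (g : A -> S) :
  p S VS g = ev p g.
Proof.
rewrite /ev (@iop_nat _ _ p (small S) S I VS of_small) //.
  by congr (p S VS _); apply: funext => a /=; rewrite to_smallK.
exact: of_small_hom.
Qed.

Lemma ev_hom A (p : Omega A) (G H : finSemigroupType) (h : G -> H) (g : A -> G) :
  is_hom h -> h (ev p g) = ev p (h \o g).
Proof.
move=> hM; apply: (@to_small_inj _); rewrite /ev of_smallK.
pose h' (x : small G) : small H := to_small (h (of_small x)).
rewrite -[LHS]/(h' (p (small G) I (to_small \o g))).
rewrite (@iop_nat _ _ p (small G) (small H) I I h'); last first.
  move=> x y; rewrite /h' of_small_hom hM; exact: to_small_hom.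
by congr (p (small H) I _); apply: funext => a; rewrite /h' /= to_smallK.
Qed.

Lemma evM A (p q : Omega A) (G : finSemigroupType) (g : A -> G) :
  ev (p * q) g = ev p g * ev q g.
Proof. exact: of_small_hom. Qed.

Lemma ev_gen A a (G : finSemigroupType) (g : A -> G) : ev (gen a) g = g a.
Proof. exact: to_smallK. Qed.

Lemma ev_inj A (p q : Omega A) :
  (forall (S : finSemigroup) (g : A -> S), ev p g = ev q g) -> p = q.
Proof. by move=> E; apply: iop_eq => S VS g; rewrite !evE. Qed.

Section Generated.
Variables (A : Type) (G : finSemigroupType) (g : A -> G).

Definition in_gen (x : G) : bool := `[< exists w, subst g w = some1 x >].

Definition gen_sort := {x : G | in_gen x}.
HB.instance Definition _ := Finite.on gen_sort.

Lemma in_genM x y : in_gen x -> in_gen y -> in_gen (x * y).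
Proof.
move=> /asboolP[u ux] /asboolP[v vy]; apply/asboolP; exists (u ++ v).
by rewrite subst_cat ux vy.
Qed.

Definition gen_mul (x y : gen_sort) : gen_sort :=
  Sub (val x * val y) (in_genM (valP x) (valP y)).

Lemma gen_mulA : associative gen_mul.
Proof. by move=> x y z; apply: val_inj; rewrite /= mulgA. Qed.

HB.instance Definition _ := isSemigroup.Build gen_sort gen_mulA.

Definition gensub : finSemigroupType := gen_sort.

Lemma in_gen_gen a : in_gen (g a).
Proof. by apply/asboolP; exists [:: a]; rewrite subst_cons subst_nil. Qed.

Definition gensub_gen a : gensub := Sub (g a) (in_gen_gen a).

Definition gensub_val (x : gensub) : G := sval x.

Lemma gensub_val_hom : is_hom gensub_val.
Proof. by []. Qed.

Lemma ext1_inj (X Y : Type) (f : X -> Y) : injective f -> injective (ext1 f).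
Proof. by move=> fI [x|] [y|] //= [] /fI ->. Qed.

Lemma gensub_generates : generates gensub_gen.
Proof.
move=> x; have /asboolP[w wx] := valP x; exists w.
apply: (@ext1_inj gensub G gensub_val); first by move=> y z; exact: val_inj.
by rewrite (ext1_subst _ _ gensub_val_hom).
Qed.
End Generated.

(** Words are dense: by naturality with respect to the inclusion, the value
    of p lies in the subsemigroup generated by the values of the letters. *)
Lemma ev_word A (p : Omega A) (G : finSemigroupType) (g : A -> G) :
  exists w, subst g w = some1 (ev p g).
Proof.
have := ev_hom p (gensub_gen g) (@gensub_val_hom _ _ g).
rewrite -[_ \o _]/g => <-; apply/asboolP.
exact: (svalP (ev p (gensub_gen g) : gen_sort g)).
Qed.

(** Approximation in two finite semigroups at once, that is, in their
    product; with pairs, it serves for any finite number of them. *)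
Lemma ev_word2 A (p : Omega A) (G H : finSemigroupType) (g : A -> G) (h : A -> H) :
  exists w, subst g w = some1 (ev p g) /\ subst h w = some1 (ev p h).
Proof.
pose gh a : (G * H)%type := (g a, h a).
have [w Ew] := ev_word p gh; exists w.
have := congr1 (ext1 fst) Ew; have := congr1 (ext1 snd) Ew.
rewrite !ext1_subst //= (ev_hom _ _ (@hom_fst _ _)) (ev_hom _ _ (@hom_snd _ _)).
by [].
Qed.

Lemma ev_pair A (p : Omega A) (G H : finSemigroupType) (g : A -> G) (h : A -> H) :
  ev p (fun a => (g a, h a)) = (ev p g, ev p h).
Proof.
rewrite [LHS]surjective_pairing (ev_hom _ _ (@hom_fst _ _)).
by rewrite (ev_hom _ _ (@hom_snd _ _)).
Qed.

Lemma cylinder_inter A (s : seq (set (Omega A))) (p : Omega A) :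
  (forall U, U \in s -> iop_subbase U /\ U p) ->
  exists (G : finSemigroupType) (g : A -> G),
    forall q, ev q g = ev p g -> forall U, U \in s -> U q.
Proof.
elim: s => [|U s IH] Hs.
  by exists (finsg unit), (fun=> tt) => q _ U; rewrite in_nil.
have [G [g Gg]] : exists (G : finSemigroupType) (g : A -> G),
    forall q, ev q g = ev p g -> forall U, U \in s -> U q.
  by apply: IH => W Ws; apply: Hs; rewrite inE Ws orbT.
have [[S [VS [h [x ->]]]] /= px] := Hs U (mem_head _ _).
exists (G * S)%type, (fun a => (g a, h a)) => q; rewrite !ev_pair => -[Eg Eh] W.
rewrite inE => /orP[/eqP->|]; last exact: Gg.
by rewrite /= evE Eh -evE.
Qed.

(** Since finite products are available, one finite semigroup defines a
    basic neighbourhood. *)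
Lemma open_ev A (U : set (Omega A)) p : open U -> U p ->
  exists (G : finSemigroupType) (g : A -> G), forall q, ev q g = ev p g -> U q.
Proof.
move=> [D' sD' <-] [B D'B Bp]; have [E sE EB] := sD' B D'B.
suff [G [g Gg]] : exists (G : finSemigroupType) (g : A -> G), forall q,
    ev q g = ev p g -> B q by exists G, g => q /Gg Bq; exists B.
have [|G [g Gg]] := @cylinder_inter A (finmap.enum_fset E) p.
  move=> W WE; split; last by move: Bp; rewrite -EB; apply.
  by have := sE W WE; rewrite inE.
by exists G, g => q /Gg qE; rewrite -EB => W /qE.
Qed.

Lemma word_ev A (w : seq A) (p : Omega A) (G : finSemigroupType)
  (g : A -> G) : word w = some1 p -> subst g w = some1 (ev p g).
Proof.
move=> wp; have evM' : is_hom (fun q : Omega A => ev q g).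
  by move=> q r; rewrite evM.
rewrite -[some1 _]/(ext1 (fun q => ev q g) (some1 p)) -wp /word.
rewrite (ext1_subst _ _ evM').
apply: eq_subst => a.
by rewrite /= ev_gen.
Qed.

Lemma word_ex A V (w : seq A) : w <> [::] -> exists p : iop V A, word w = some1 p.
Proof. by case: w => [|a w] //; move=> _; apply: subst_some. Qed.

(** By density of the words, a continuous homomorphism is determined by the
    images of the letters. *)
Lemma delta_ev (A : Type) (S : finSemigroup) (g : A -> S) delta p :
  is_delta g delta -> delta p = ev p g.
Proof.
move=> [dopen dM dg].
have [G [h Gh]] := open_ev (dopen (delta p)) (erefl (delta p)).
have [w [wh wg]] := ev_word2 p h g.
have [q wq] : exists q : Omega A, word w = some1 q.
  by apply: word_ex => w0; move: wh; rewrite w0 subst_nil.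
have <- : delta q = delta p.
  by apply: Gh; apply: some1_inj; rewrite -(word_ev _ wq).
apply: some1_inj; rewrite -wg.
rewrite -[some1 _]/(ext1 delta (some1 q)) -wq /word (ext1_subst _ _ dM).
apply: eq_subst => a.
by rewrite /= dg.
Qed.

Lemma subbase_open A (U : set (Omega A)) : iop_subbase U -> open U.
Proof.
move=> UB; exists [set U]; last by rewrite bigcup_set1.
by move=> _ ->; exact: (finI_from1 id UB).
Qed.

Lemma open_ev_fiber A (G : finSemigroupType) (g : A -> G) x :
  open [set p : Omega A | ev p g = x].
Proof.
apply: subbase_open; exists (small G), I, (to_small \o g), (to_small x).
rewrite predeqE => p /=; rewrite /ev.
by split=> [<-|->]; rewrite ?of_smallK ?to_smallK.
Qed.

(** The operations with the same value as e are a neighbourhood of e, hence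
    contain a power of p. *)
Lemma omega_ev (A : Type) (p e : Omega A) (G : finSemigroupType) (g : A -> G) :
  is_omega p e ->
  ev e g * ev e g = ev e g /\ exists n, some1 (ev e g) = some1 (ev p g) ^+ n.+1.
Proof.
move=> [ee cle]; split; first by rewrite -evM ee.
have [|q [[n qn] /= Eq]] := cle [set q | ev q g = ev e g].
  by apply: open_nbhs_nbhs; split=> //; exact: open_ev_fiber.
exists n; rewrite -Eq.
have evM' : is_hom (fun q : Omega A => ev q g) by move=> r s; rewrite evM.
rewrite -[some1 _]/(ext1 (fun q : Omega A => ev q g) (some1 q)) qn.
elim: n.+1 => [|m IH]; first by rewrite !expg0.
by rewrite !expgS (ext1M evM') IH.
Qed.

(** * Satisfaction of an identity in a pseudovariety *)

(** The relation V |= p = q, tested on values. *)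
Definition sat (V : set finSemigroup) (A : Type) (p q : Omega A) : Prop :=
  forall S : finSemigroup, V S -> forall g : A -> S, ev p g = ev q g.

Lemma modelsP V A (p q : Omega A) :
  models V (some1 p) (some1 q) <-> sat V p q.
Proof.
split=> [[/= E] S VS g|E].
  by have := congr1 (fun r => r S VS g) E; rewrite /= !evE.
congr Some; apply: iop_eq => S VS g; rewrite /= !evE; exact: E.
Qed.

Lemma sat_refl V A (p : Omega A) : sat V p p.
Proof. by []. Qed.

Lemma sat_sym V A (p q : Omega A) : sat V p q -> sat V q p.
Proof. by move=> E S VS g; rewrite E. Qed.

Lemma sat_trans V A (p q r : Omega A) : sat V p q -> sat V q r -> sat V p r.
Proof. by move=> E F S VS g; rewrite E // F. Qed.

Lemma sat_small (V : set finSemigroup) (A : Type) (p q : Omega A)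
  (G : finSemigroupType) (g : A -> G) :
  sat V p q -> V (small G) -> ev p g = ev q g.
Proof.
move=> pq VG; apply: to_small_inj; have toM := @to_small_hom G.
by rewrite !(ev_hom _ _ toM) (pq _ VG).
Qed.

(** Reiterman's easy half, for the identity p = q: it makes it enough to
    check an identity on generators of a pseudovariety. *)
Lemma satisfy_pv A (p q : Omega A) :
  pseudovariety (fun S : finSemigroup => forall g : A -> S, ev p g = ev q g).
Proof.
split.
- by move=> g; case: (ev p g); case: (ev q g).
- move=> S T Sp Tp g.
  have f1 : @is_hom (finsg (dirprod S T)) S fst by [].
  have f2 : @is_hom (finsg (dirprod S T)) T snd by [].
  apply: etrans (surjective_pairing _) (etrans _ (esym (surjective_pairing _))).
  congr pair.
    exact: etrans (ev_hom p g f1) (etrans (Sp _) (esym (ev_hom q g f1))).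
  exact: etrans (ev_hom p g f2) (etrans (Tp _) (esym (ev_hom q g f2))).
- by move=> S T h hM hI Sp g; apply: hI; rewrite !ev_hom.
- move=> S T h hM hS Sp g.
  (* the assignment in the quotient is lifted to S *)
  have [f fE] := boolp.choice hS.
  have -> : g = h \o (f \o g) by apply: funext => a /=; rewrite fE.
  by rewrite -(ev_hom p (f \o g) hM) -(ev_hom q (f \o g) hM) Sp.
Qed.

Lemma pv_sd_sat (V W : set finSemigroup) A (p q : Omega A) :
  (forall (S T : finSemigroup) (a : endo_action S T), V S -> W T ->
    forall g : A -> finsg (semidirect a), ev p g = ev q g) ->
  sat (pv_sd V W) p q.
Proof.
move=> E R RVW; refine (RVW _ (satisfy_pv p q) _).
by move=> _ [S [T [a [VS WT ->]]]]; apply: E.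
Qed.

Section Membership.
Variables (V : set finSemigroup) (hV : pseudovariety V).

Lemma pv_power_ord (S : finSemigroup) n : V S -> V (small {ffun 'I_n -> S}).
Proof.
move=> VS; elim: n => [|n IH].
  pose h (x : small {ffun 'I_0 -> S}) : finsg unit := tt.
  apply: (pv_sub hV (h := h) _ _ (pv_unit hV)) => // x y _.
  by apply: (@of_small_inj _); apply/ffunP => -[].
pose h (x : small {ffun 'I_n.+1 -> S}) :
    finsg (dirprod S (small {ffun 'I_n -> S})) :=
  (of_small x ord0, to_small [ffun i => of_small x (lift ord0 i)]).
apply: (pv_sub hV (h := h) _ _ (pv_prod hV VS IH)).
  move=> x y; rewrite /h of_small_hom; congr pair; first by rewrite ffunE.
  rewrite -[RHS]to_small_hom; congr to_small.
  by apply/ffunP => i; rewrite !ffunE.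
move=> x y E; have E0 := congr1 fst E; have /= E1' := congr1 snd E.
have /ffunP E1 := to_small_inj E1'.
apply: (@of_small_inj _); apply/ffunP => i.
by case: (unliftP ord0 i) => [j|] ->; [have := E1 j; rewrite !ffunE|].
Qed.

Lemma pv_power (S : finSemigroup) (I : finType) : V S -> V (small {ffun I -> S}).
Proof.
move=> VS.
pose h (x : small {ffun I -> S}) : small {ffun 'I_#|I| -> S} :=
  to_small [ffun i => of_small x (enum_val i)].
apply: (pv_sub hV (h := h) _ _ (pv_power_ord #|I| VS)).
  move=> x y; rewrite /h of_small_hom -[RHS]to_small_hom; congr to_small.
  by apply/ffunP => i; rewrite !ffunE.
move=> x y E'; have /ffunP E := to_small_inj E'.
apply: (@of_small_inj _); apply/ffunP => i.
by have := E (enum_rank i); rewrite !ffunE enum_rankK.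
Qed.
End Membership.

(** * Sigma-operations: products, substitutions and omega-powers *)

Section Sigma.
Variables (sg : set operation) (A : Type).
Hypothesis sgM : implicit_signature sg.

Lemma Omega_sigM (p q : Omega A) :
  Omega_sig sg A p -> Omega_sig sg A q -> Omega_sig sg A (p * q).
Proof.
move=> sp sq.
have -> : p * q = iop_comp (gen (ord0 : 'I_2) * gen (ord_max : 'I_2))
    (fun i : 'I_2 => if i == ord0 then p else q).
  by apply: iop_eq => S VS g.
by apply: Omega_sig_op => // i; case: ifP.
Qed.

Lemma Omega_sig_word w (p : Omega A) : word w = some1 p -> Omega_sig sg A p.
Proof.
case/lastP: w => [|w a]; first by rewrite /word subst_nil.
elim/last_ind: w a p => [|w b IH] a p; rewrite /word subst_rcons.
  by rewrite subst_nil mul1g => -[<-]; constructor.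
case E: (subst gen _) => [q|] [<-]; last by constructor.
by apply: Omega_sigM; [exact: IH E | constructor].
Qed.

Definition mul_word (p : Omega A) w := foldl (fun p a => p * gen a) p w.
Definition word_mul w (p : Omega A) := foldr (fun a p => gen a * p) p w.

Lemma Omega_sig_mul_word p w : Omega_sig sg A p -> Omega_sig sg A (mul_word p w).
Proof.
elim: w p => //= a w IH p sp.
by apply: IH; apply: Omega_sigM => //; constructor.
Qed.

Lemma Omega_sig_word_mul w p : Omega_sig sg A p -> Omega_sig sg A (word_mul w p).
Proof.
by move=> sp; elim: w => //= a w IH; apply: Omega_sigM => //; constructor.
Qed.

Lemma ev_mul_word (G : finSemigroupType) (g : A -> G) p w :
  some1 (ev (mul_word p w) g) = some1 (ev p g) * subst g w.
Proof.
elim: w p => [|a w IH] p /=; first by rewrite subst_nil mulg1.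
by rewrite IH subst_cons mulgA evM ev_gen.
Qed.

Lemma ev_word_mul (G : finSemigroupType) (g : A -> G) w p :
  some1 (ev (word_mul w p) g) = subst g w * some1 (ev p g).
Proof.
elim: w => [|a w IH] /=; first by rewrite subst_nil mul1g.
by rewrite subst_cons -mulgA -IH evM ev_gen.
Qed.

Lemma isubst_nat (B : Type) (p : Omega B) (f : B -> Omega A)
    (G H : finSemigroupType) (h : G -> H) (g : A -> G) : is_hom h ->
  h (ev p (fun b => ev (f b) g)) = ev p (fun b => ev (f b) (h \o g)).
Proof.
move=> hM; rewrite (ev_hom _ _ hM); congr ev; apply: funext => b /=.
exact: ev_hom.
Qed.

(** Substitution for an arbitrary, possibly infinite, set of variables, with
    [iop_comp] as the special case of variables ['I_n]. *)
Definition isubst (B : Type) (p : Omega B) (f : B -> Omega A) : Omega A :=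
  Iop (fun (S T : finSemigroup) _ _ (h : S -> T) hM g => isubst_nat p f g hM).

Lemma ev_isubst (B : Type) (p : Omega B) (f : B -> Omega A)
    (G : finSemigroupType) (g : A -> G) :
  ev (isubst p f) g = ev p (fun b => ev (f b) g).
Proof.
rewrite [LHS]/ev /= (isubst_nat p f _ (@of_small_hom G)).
congr ev; apply: funext => b; congr ev; apply: funext => a.
by rewrite /= to_smallK.
Qed.

Lemma ev_comp (B : Type) n (p : Omega 'I_n) (q : 'I_n -> Omega B)
    (G : finSemigroupType) (g : B -> G) :
  ev (iop_comp p q) g = ev p (fun i => ev (q i) g).
Proof.
rewrite /ev /=; congr of_small; congr (p (small G) I _).
by apply: funext => i /=; rewrite of_smallK.
Qed.

Lemma Omega_sig_isubst (B : Type) (p : Omega B) (f : B -> Omega A) :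
  Omega_sig sg B p -> (forall b, Omega_sig sg A (f b)) ->
  Omega_sig sg A (isubst p f).
Proof.
move=> sp sf; elim: {p} sp => [b|n p q pn _ IH].
  by have -> : isubst (gen b) f = f b
    by apply: ev_inj => S g; rewrite ev_isubst ev_gen.
have -> : isubst (iop_comp p q) f = iop_comp p (fun i => isubst (q i) f).
  apply: ev_inj => S g; rewrite ev_isubst !ev_comp; congr ev.
  by apply: funext => i; rewrite ev_isubst.
exact: Omega_sig_op.
Qed.
End Sigma.

Lemma Omega_sig_eval (sg : set operation) nu A (t : term nu A) :
  range nu = sg -> Omega_sig sg A (Defs.eval t).
Proof.
move=> nusg; elim: t => [a|i ts IH] /=; first by constructor.
by apply: Omega_sig_op => //; rewrite -nusg; exists i => //; case: (nu i).
Qed.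

(** The omega-powers are given over the alphabets ['I_n]; renaming letters
    by a substitution transports them to any finite alphabet. *)
Lemma sigma_omega (sg : set operation) nu (A : finType) (u : seq A) :
  range nu = sg -> implicit_signature sg -> computable_omega_words nu -> u <> [::] ->
  exists e : Omega A, [/\ Omega_sig sg A e, e * e = e &
    forall (G : finSemigroupType) (g : A -> G),
      exists n, some1 (ev e g) = subst g u ^+ n.+1].
Proof.
move=> nusg sgM [f fP] u0; pose u' := [seq enum_rank a | a <- u].
have [|p pE] := @word_ex _ pvS u'; first by case: u u0 @u'.
have [t [_ te]] := fP _ u' p pE.
exists (isubst (Defs.eval t) (fun i => gen (enum_val i))).
split.
- by apply: Omega_sig_isubst => [|b]; [exact: Omega_sig_eval | constructor].
- apply: ev_inj => S g; rewrite evM ev_isubst.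
  by have [] := omega_ev (fun i => ev (gen (enum_val i)) g) te.
- move=> G g; have [_ [n nE]] := omega_ev (fun i => ev (gen (enum_val i)) g) te.
  exists n; rewrite ev_isubst nE -(word_ev _ pE) subst_map.
  congr (_ ^+ _); apply: eq_subst => a /=.
  by rewrite ev_gen enum_rankK.
Qed.

(** * Windows of a word and the free definite semigroup *)

Section Suffix.
Variables (A : Type) (k : nat).
Implicit Types u v w : seq A.

Lemma tk_id w : size w <= k -> tk k w = w :> seq A.
Proof. by move=> wk; rewrite /= (eqP wk) drop0. Qed.

Lemma tk_suffix u v : k <= size v -> tk k (u ++ v) = tk k v :> seq A.
Proof.
move=> kv; rewrite /= size_cat -addnBA // drop_cat ltnNge leq_addr /=.
by rewrite addKn.
Qed.

Lemma tk_size w : size (tk k w) = minn (size w) k.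
Proof. by rewrite /= size_drop minnE. Qed.

Lemma tk_split w : exists u, w = u ++ tk k w.
Proof. by exists (take (size w - k) w); rewrite cat_take_drop. Qed.

Lemma tk_eq u v : tk k u = tk k v :> seq A -> tk k u = tk k v.
Proof. exact: val_inj. Qed.

Lemma tk_catl u v : tk k (tk k u ++ v) = tk k (u ++ v).
Proof.
apply: tk_eq; case: (leqP (size u) k) => uk; first by rewrite (tk_id uk).
have [x ux] := tk_split u.
rewrite {2}ux -catA [in RHS]tk_suffix // size_cat tk_size.
by rewrite (minn_idPr (ltnW uk)) leq_addr.
Qed.

Lemma tk_catr u v : tk k (u ++ tk k v) = tk k (u ++ v).
Proof.
apply: tk_eq; case: (leqP (size v) k) => vk; first by rewrite (tk_id vk).
have [x vx] := tk_split v.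
have kt : k <= size (tk k v) by rewrite tk_size (minn_idPr (ltnW vk)).
by rewrite {2}vx catA !(tk_suffix _ kt).
Qed.

Lemma tk_bseq (q : k.-bseq A) : tk k q = q.
Proof. by apply: val_inj; apply: tk_id; apply: size_bseq. Qed.
End Suffix.

Section Windows.
Variables (A : finType) (k : nat).
Notation window := (k.-bseq A).
Implicit Types (q : window) (u v w : seq A).

(** The relabelling of w as a word of pairs (window, letter), when the
    letters q have been read before w; for q empty this is [beta_word].  Only
    the current window is kept as a state. *)
Fixpoint windows q w : seq (window * A) :=
  if w is a :: w' then (q, a) :: windows (tk k (rcons q a)) w' else [::].

Lemma windows_cat q u v :
  windows q (u ++ v) = windows q u ++ windows (tk k (q ++ u)) v.
Proof.
elim: u q => [|a u IH] q /=; first by rewrite cats0 tk_bseq.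
by rewrite IH tk_catl cat_rcons.
Qed.

Lemma windows_size q u b : b \in windows q u ->
  size q <= size b.1 /\ size b.1 < size q + size u.
Proof.
elim: u q => [|a u IH] q //=; rewrite inE => /orP[/eqP->|/IH] /=.
  by rewrite addnS ltnS leq_addr.
have -> : size (tk k (rcons q a)) = minn (size q).+1 k.
  by rewrite tk_size size_rcons.
move=> [lo hi]; split.
  by apply: leq_trans lo; rewrite leq_min leqnSn size_bseq.
by apply: leq_trans hi _; rewrite addnS -addSn leq_add2r geq_minl.
Qed.

Lemma windows_split u a v : windows [bseq] (u ++ a :: v) =
  windows [bseq] u ++ (tk k u, a) :: windows (tk k (rcons u a)) v.
Proof. by rewrite windows_cat /= -cats1 tk_catl cats1. Qed.

Lemma windows_rcons q w a :
  windows q (rcons w a) = rcons (windows q w) (tk k (q ++ w), a).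
Proof. by rewrite -!cats1 windows_cat. Qed.

(** The free semigroup of D_(k+1): the pair (q, a) stands for the nonempty word
    q a of length at most k + 1, and a product keeps the last k + 1 letters. *)
Definition definite := (window * A)%type.
HB.instance Definition _ := Finite.on definite.

Definition flat (t : definite) : seq A := rcons t.1 t.2.

Definition definite_mul (t u : definite) : definite :=
  (tk k (flat t ++ u.1), u.2).

Lemma tk_flat q (t u : definite) :
  tk k (q ++ flat (definite_mul t u)) = tk k (tk k (q ++ flat t) ++ flat u).
Proof.
rewrite /flat; case: t u => [t a] [u b].
rewrite -[(definite_mul _ _).1]/(tk k (rcons t a ++ u)) /= -!cats1.
by rewrite catA -tk_catl tk_catr !tk_catl !catA.
Qed.

Lemma definite_mulA : associative definite_mul.
Proof.
move=> [t a] [u b] [v c]; congr pair; rewrite /flat.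
rewrite -[(definite_mul _ _).1]/(tk k (rcons u b ++ v)).
rewrite -[(definite_mul _ _).1]/(tk k (rcons t a ++ u)) tk_catr.
by rewrite [in RHS]cat_rcons tk_catl -catA !cat_rcons.
Qed.

HB.instance Definition _ := isSemigroup.Build definite definite_mulA.

(** An idempotent word q a has length k + 1, for otherwise its square would
    be longer; so it erases whatever stands to its left. *)
Lemma definite_D : pvD (small definite).
Proof.
move=> _ y e [ee _]; apply: of_small_inj; rewrite of_small_hom.
have := congr1 of_small ee; rewrite of_small_hom; move: (of_small e) => [q a].
move: (of_small y) => t.
have full (u : definite) : size q = k -> u * ((q, a) : definite) = (q, a).
  move=> qk; congr pair; apply: val_inj.
  have kq : k <= size q by rewrite qk.
  by apply: etrans (tk_suffix _ kq) _; rewrite tk_bseq.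
move=> E0; apply: full; have {E0} := congr1 (fun t : definite => size t.1) E0.
rewrite -[X in size X]/(tk k (flat (q, a) ++ q) : seq A) tk_size size_cat.
move=> E; apply/eqP; rewrite eqn_leq size_bseq /= leqNgt.
apply/negP => qk; move: E; rewrite /minn /flat size_rcons; case: ifP => _ E.
  by move: (leqnn (size q)); rewrite -{1}E addSn ltnNge leq_addr.
by move: qk; rewrite -E ltnn.
Qed.

Definition definite_gen (a : A) : definite := ([bseq], a).

Lemma definite_gen_state w (t : definite) q :
  subst definite_gen w = some1 t -> tk k (q ++ flat t) = tk k (q ++ w).
Proof.
elim: w t q => [|a w IH] t q; first by rewrite subst_nil.
rewrite subst_cons; case E: (subst definite_gen w) => [u|] [<-].
  by rewrite tk_flat (IH u) // tk_catl -catA.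
by case: w E {IH} => // b w; have [u ->] := subst_some definite_gen b w.
Qed.

Section Expansion.
Variable G : finSemigroupType.

(** The left action of words on functions of windows: f is evaluated at the
    window seen once t has been read. *)
Definition shift (t : definite) (f : {ffun window -> G}) : {ffun window -> G} :=
  [ffun q : window => f (tk k (q ++ flat t))].

Lemma shiftM (t u : definite) f : shift (t * u) f = shift t (shift u f).
Proof. by apply/ffunP => q; rewrite !ffunE -tk_flat. Qed.

Lemma shift_hom t : is_hom (shift t).
Proof. by move=> f h; apply/ffunP => q; rewrite !ffunE. Qed.

(** The semidirect product in which a letter may be evaluated according to
    the window that precedes it. *)
Definition expansion := ({ffun window -> G} * definite)%type.
HB.instance Definition _ := Finite.on expansion.

Definition expansion_mul (x y : expansion) : expansion :=
  (x.1 * shift x.2 y.1, x.2 * y.2).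

Lemma expansion_mulA : associative expansion_mul.
Proof.
by move=> x y z; rewrite /expansion_mul /= shift_hom shiftM !mulgA.
Qed.

HB.instance Definition _ := isSemigroup.Build expansion expansion_mulA.

Definition exp_gen (h : window * A -> G) (a : A) : expansion :=
  ([ffun q => h (q, a)], definite_gen a).

(** The q-th coordinate of the first component reads w from the window q, so
    the expansion evaluates the relabelled word. *)
Lemma exp_value h w q :
  ext1 (fun x : expansion => x.1 q) (subst (exp_gen h) w)
  = subst h (windows q w).
Proof.
elim: w q => [|a w IH] q /=; first by rewrite !subst_nil.
rewrite !subst_cons -IH.
have e : tk k (q ++ flat ([bseq] : window, a)) = tk k (rcons q a).
  by rewrite /flat /= cats1.
case: (subst (exp_gen h) w) => [[f t]|] /=; congr Some; last by rewrite ffunE.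
by rewrite -[LHS]/((_ * _ : {ffun window -> G}) q) !ffunE e.
Qed.

Lemma exp_gen_state h w (x : expansion) :
  subst (exp_gen h) w = some1 x -> subst definite_gen w = some1 x.2.
Proof.
move=> wx; have sndM : @is_hom expansion definite snd by [].
by rewrite -[some1 x.2]/(ext1 snd (some1 x)) -wx (ext1_subst _ _ sndM).
Qed.

Lemma ev_exp_snd (p : Omega A) h : (ev p (exp_gen h)).2 = ev p definite_gen.
Proof.
have sndM : @is_hom expansion definite snd by [].
exact: (ev_hom p (exp_gen h) sndM).
Qed.

Definition small_shift (t : small definite) (f : small {ffun window -> G}) :
    small {ffun window -> G} :=
  to_small (shift (of_small t) (of_small f)).

Lemma small_shiftM (t u : small definite) f :
  small_shift (t * u) f = small_shift t (small_shift u f).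
Proof. by rewrite /small_shift of_small_hom shiftM to_smallK. Qed.

Lemma small_shift_hom t : is_hom (small_shift t).
Proof.
by move=> f h; rewrite /small_shift of_small_hom shift_hom to_small_hom.
Qed.

Definition shift_action := EndoAction small_shiftM small_shift_hom.

End Expansion.

Lemma expansion_sd (V : set finSemigroup) (S : finSemigroup) :
  pseudovariety V -> V S -> pv_sd V pvD (small (expansion S)).
Proof.
move=> hV VS U pvU CU.
pose h (x : small (expansion S)) : finsg (semidirect (shift_action S)) :=
  (to_small (of_small x).1, to_small (of_small x).2).
apply: (pv_sub pvU (h := h)).
- move=> x y; rewrite /h of_small_hom.
  rewrite -[RHS]/(to_small (of_small x).1 * small_shift (to_small (of_small x).2)
    (to_small (of_small y).1), to_small (of_small x).2 * to_small (of_small y).2).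
  by rewrite /small_shift !to_smallK -!to_small_hom.
- move=> x y E; apply: of_small_inj; rewrite [LHS]surjective_pairing.
  rewrite [RHS]surjective_pairing; congr pair.
    by apply: to_small_inj; exact: (congr1 fst E).
  by apply: to_small_inj; exact: (congr1 snd E).
- apply: CU.
  exists (small {ffun window -> S}), (small definite), (shift_action S).
  by split=> //; [exact: pv_power | exact: definite_D].
Qed.

Definition exp_map (G H : finSemigroupType) (h : G -> H) (x : expansion G) :
  expansion H := ([ffun q => h (x.1 q)], x.2).

Lemma exp_map_hom (G H : finSemigroupType) (h : G -> H) :
  is_hom h -> is_hom (exp_map h).
Proof.
move=> hM x y; congr pair; apply/ffunP => q.
by rewrite /= !ffunE hM.
Qed.

Lemma exp_map_gen (G H : finSemigroupType) (h : G -> H) (g : window * A -> G) :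
  exp_map h \o exp_gen g = exp_gen (h \o g).
Proof.
by apply: funext => a; congr pair; apply/ffunP => q; rewrite !ffunE.
Qed.

Definition beta_val (p : Omega A) (G : finSemigroupType) (h : window * A -> G) :
  G := (ev p (exp_gen h)).1 [bseq].

Lemma beta_val_hom p (G H : finSemigroupType) (h : G -> H) g :
  is_hom h -> h (beta_val p g) = beta_val p (h \o g).
Proof.
move=> hM; rewrite /beta_val -exp_map_gen -(ev_hom _ _ (exp_map_hom hM)).
by rewrite ffunE.
Qed.

(** The extension of [windows] from words to implicit operations.  It is read
    off from the expansions instead of being extended by continuity. *)
Definition beta (p : Omega A) : Omega (window * A) :=
  Iop (fun (S T : finSemigroup) _ _ (h : S -> T) hM g => beta_val_hom p g hM).

Lemma ev_beta p (G : finSemigroupType) (h : window * A -> G) :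
  ev (beta p) h = (ev p (exp_gen h)).1 [bseq].
Proof.
rewrite /ev /= (beta_val_hom p _ (@of_small_hom G)) -/(beta_val p h).
by congr beta_val; apply: funext => b /=; rewrite to_smallK.
Qed.

(** The last k letters of p, that is, t_k p. *)
Definition suffix_of (p : Omega A) : window := tk k (flat (ev p definite_gen)).

(** The same word approximates p, its relabelling approximates beta p, and
    its last k letters are exactly those of p. *)
Lemma beta_approx p (G H : finSemigroupType) (g : A -> G) (h : window * A -> H) :
  exists w, [/\ subst g w = some1 (ev p g),
    subst h (windows [bseq] w) = some1 (ev (beta p) h) & tk k w = suffix_of p].
Proof.
have [w [wg wh]] := ev_word2 p g (exp_gen h); exists w; split=> //.
  by rewrite -exp_value wh ev_beta.
have := exp_gen_state wh; rewrite ev_exp_snd => /definite_gen_state E.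
by rewrite -[w]cat0s -(E [bseq]).
Qed.

(** The value of beta p in a member S of V is read in the expansion of S,
    which belongs to V * D.  The other component of that expansion gives the last
    letters. *)
Lemma beta_sat (V : set finSemigroup) (p q : Omega A) : pseudovariety V ->
  sat (pv_sd V pvD) p q -> sat V (beta p) (beta q) /\ suffix_of p = suffix_of q.
Proof.
move=> hV pq; have E (S : finSemigroup) (g : A -> expansion S) :
    V S -> ev p g = ev q g.
  by move=> VS; apply: (sat_small _ pq); exact: expansion_sd.
split=> [S VS g|]; first by rewrite !ev_beta E.
(* the trivial semigroup leaves only the definite component *)
have unitE := E _ (exp_gen (fun=> tt : finsg unit)) (pv_unit hV).
by have := congr1 snd unitE; rewrite /suffix_of !ev_exp_snd => ->.
Qed.
End Windows.

(** * Common prefixes *)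

Section Prefix.
Variables (A : finType) (k : nat).
Notation window := (k.-bseq A).
Implicit Types (u v w : seq A).

Section Marker.
Variables (G : finSemigroupType) (e m : G).
Hypotheses (ee : e * e = e) (em : e * m = m) (me : m * e = m) (eDm : m <> e).

(** All coordinates are followed at the same time, since the pair to look for
    depends on the word. *)
Definition marker (b : window * A) : {ffun window * A -> G} :=
  [ffun c => if c == b then m else e].

(** The windows grow by one letter until they have length k, so only one
    letter of the relabelled word has a window of length k - 1.  All other letters
    are sent to e, which is neutral for e and m. *)
Lemma marker_value u a v (c : window * A) :
  (size u).+1 = k -> size c.1 = size u ->
  ext1 (fun f : {ffun window * A -> G} => f c)
    (subst marker (windows [bseq] (u ++ a :: v)))
  = some1 (if c == (tk k u, a) then m else e).
Proof.
move=> uk cu.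
have evcM : is_hom (fun f : {ffun window * A -> G} => f c).
  by move=> f h; rewrite ffunE.
rewrite (ext1_subst _ _ evcM) windows_split subst_cat subst_cons.
set f := _ \o marker.
have fE (b : window * A) : size b.1 <> size u -> f b = e.
  by rewrite /f /= ffunE; case: eqP => // <-; rewrite cu.
rewrite (_ : f (tk k u, a) = if c == (tk k u, a) then m else e); last first.
  by rewrite /f /= ffunE.
set F := if _ then m else e.
have [eF Fe] : e * F = F /\ F * e = F by rewrite /F; case: ifP.
rewrite (@subst_absorb _ _ f (some1 F) e); last first.
- move=> b /windows_size[+ _]; rewrite tk_size size_rcons => ub.
  by apply: fE => ub'; move: ub; rewrite ub' geq_min -uk ltnn.
- by rewrite -some1M Fe.
apply: (@subst_absorb_l _ _ f (some1 F) e); first by rewrite -some1M eF.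
move=> b /windows_size[_]; rewrite add0n => ub.
by apply: fE => ub'; move: ub; rewrite ub' ltnn.
Qed.

Lemma marker_prefix w w' : 0 < k -> k <= size w -> k <= size w' ->
  subst marker (windows [bseq] w) = subst marker (windows [bseq] w') ->
  take k w = take k w'.
Proof.
have split_at v : 0 < k -> k <= size v -> exists u a v',
    [/\ v = u ++ a :: v', (size u).+1 = k & take k v = rcons u a].
  move=> k0 kv; case: (lastP (take k v)) (size_takel kv) (cat_take_drop k v).
    by move=> k0'; rewrite -k0' in k0.
  move=> u a; rewrite size_rcons => uk vE; exists u, a, (drop k v).
  by rewrite -cat_rcons.
move=> k0 /(split_at _ k0)[u [a [v [-> uk ->]]]].
move=> /(split_at _ k0)[u' [a' [v' [-> u'k ->]]]].
move=> /(congr1 (ext1 (fun f : {ffun window * A -> G} => f (tk k u, a)))).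
have tuE (t : seq A) : (size t).+1 = k -> tk k t = t :> seq A.
  by move=> <-; apply: tk_id.
have uu' : size u = size u' by apply: succn_inj; rewrite uk.
rewrite !marker_value //= ?tuE ?uu' // eqxx.
case: eqP => [[E ->] _|_ [] //].
by rewrite -(tuE u) // -(tuE u') // /tk /= E.
Qed.
End Marker.

(** With e idempotent and m = e y e different from e, all in a member of V,
    the values e and m suffice to recognize the kth letter together with its
    window, which form the prefix of length k. *)
Lemma prefix_detect (V : set finSemigroup) : pseudovariety V -> ~ (V `<=` pvLI) ->
  0 < k ->
  exists (H : finSemigroupType) (h : window * A -> H),
    (forall p q : Omega (window * A), sat V p q -> ev p h = ev q h) /\
    forall w w', k <= size w -> k <= size w' ->
      subst h (windows [bseq] w) = subst h (windows [bseq] w') ->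
      take k w = take k w'.
Proof.
move=> hV VLI k0.
have [S [VS [x [y [e [[ee _] eye]]]]]] : exists S : finSemigroup, V S /\
    exists x y e : S, omega_fin x e /\ e * y * e <> e.
  apply: contrapT => H; apply: VLI => S VS x y e xe; apply: contrapT => eye.
  by apply: H; exists S; split=> //; exists x, y, e.
exists {ffun window * A -> S}, (marker e (e * y * e)); split.
  by move=> p q /sat_small; apply; exact: pv_power.
move=> w w'; apply: marker_prefix => //; first by rewrite !mulgA ee.
by rewrite -!mulgA ee.
Qed.
End Prefix.

(** * The cut of a window *)

Section Cut.
Variables (A : finType) (S : finSemigroupType) (g : A -> S).
Implicit Types (q r u : seq A).

(** The prefix of length j of q has the same value as a shorter one.  Values
    are taken in S with a new identity adjoined, so that the shorter prefix
    cannot be empty unless the longer one is. *)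
Definition repeats q j : bool :=
  has (fun i => subst g (take i q) == subst g (take j q)) (iota 0 j).

(** The length of the first prefix that repeats the value of a shorter one; it
    exceeds [size q] when there is none. *)
Definition cut q : nat := find (repeats q) (iota 0 (size q).+1).

Lemma repeatsP q j :
  reflect (exists2 i, i < j & subst g (take i q) = subst g (take j q))
    (repeats q j).
Proof.
apply: (iffP hasP) => [[i]|[i ij E]].
  by rewrite mem_iota => ij /eqP E; exists i.
by exists i; [rewrite mem_iota | apply/eqP].
Qed.

Lemma cut_min q j : j <= size q -> repeats q j -> cut q <= j.
Proof.
move=> jq qj; rewrite leqNgt; apply/negP => /(before_find 0).
by rewrite nth_iota ?add0n ?ltnS // qj.
Qed.

Lemma repeats_pigeonhole q : #|S| < size q -> has (repeats q) (iota 0 (size q).+1).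
Proof.
move=> Sq; pose f (i : 'I_(size q)) := subst g (take i.+1 q).
have /boolp.choice[s sE] i : exists s, f i = some1 s.
  by rewrite /f; case: q {Sq f} i => [[] //|a q] i; exact: subst_some.
(* prefixes are indexed by their lengths minus one, to be nonempty *)
have /injectivePn[i [j ij E]] : ~~ injectiveb s.
  apply/negP => /injectiveP/leq_card; rewrite card_ord leqNgt.
  by rewrite Sq.
wlog ltij : i j ij E / i < j.
  move=> W; case: (ltngtP i j) => [||/val_inj H]; first exact: W.
    by apply: W; rewrite // eq_sym.
  by rewrite H eqxx in ij.
apply/hasP; exists j.+1; first by rewrite mem_iota /= add0n ltnS ltn_ord.
by apply/repeatsP; exists i.+1 => //; rewrite -/(f i) -/(f j) !sE E.
Qed.

Lemma cut_le q : #|S| < size q -> cut q <= size q.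
Proof. by move=> /repeats_pigeonhole; rewrite has_find size_iota ltnS. Qed.

Lemma cut_period q : #|S| < size q ->
  exists2 u, u <> [::] &
    subst g (take (cut q) q) * subst g u = subst g (take (cut q) q).
Proof.
move=> Sq; have := nth_find 0 (repeats_pigeonhole Sq).
rewrite -/(cut q) nth_iota ?ltnS ?cut_le //.
rewrite add0n => /repeatsP[i ij E]; exists (drop i (take (cut q) q)).
  move/(congr1 size)/eqP; rewrite size_drop size_takel ?cut_le //.
  by rewrite subn_eq0 leqNgt ij.
rewrite -{1}E -subst_cat; congr subst.
by rewrite -{2}(cat_take_drop i (take (cut q) q)) take_takel // ltnW.
Qed.

(** A repetition inside the next window r b that ends before b is also a
    repetition inside a r, one position further to the right: equal values stay
    equal when multiplied on the left by a.  If it ends at b, there is nothing to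
    prove, as the cut of a r is at most its length. *)
Lemma cut_shift a r b : cut (a :: r) <= size (a :: r) ->
  cut (a :: r) <= (cut (rcons r b)).+1.
Proof.
move=> le; case: (ltnP (size r) (cut (rcons r b))) => H.
  by apply: leq_trans le _; rewrite /= ltnS ltnW.
have H' : cut (rcons r b) <= size (rcons r b) by rewrite size_rcons ltnW.
apply: cut_min; first by rewrite /= ltnS.
have := nth_find 0 (a := repeats (rcons r b)) (s := iota 0 (size (rcons r b)).+1).
rewrite has_find size_iota -/(cut _) ltnS nth_iota // add0n => /(_ H').
set j := cut _ in H *; move=> /repeatsP[i ij].
have ir : i <= size r by apply: leq_trans (ltnW ij) H.
rewrite -cats1 !takel_cat // => E.
by apply/repeatsP; exists i.+1 => //=; rewrite !subst_cons E.
Qed.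
End Cut.

(** * Inserting idempotents at the cuts *)

Section Brandt.
Variable Q : finType.
(** The Brandt semigroup of pairs over Q, with [None] as zero: a product of
    edges is nonzero if and only if they form a path, and then it gives the ends
    of that path. *)
Definition brandt := option (Q * Q).
HB.instance Definition _ := Finite.on brandt.
Definition brandt_mul (x y : brandt) : brandt :=
  if (x, y) is (Some (p, q), Some (p', q')) then
    if q == p' then Some (p, q') else None
  else None.
Lemma brandt_mulA : associative brandt_mul.
Proof.
move=> [[p q]|] [[p' q']|] [[r s]|] //=; rewrite /brandt_mul; try by case: ifP.
by case E: (q' == r); case F: (q == p'); rewrite /= ?E ?F.
Qed.
HB.instance Definition _ := isSemigroup.Build brandt brandt_mulA.
End Brandt.

Section Core.
Variables (A : finType) (S : finSemigroupType) (g : A -> S).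
Variables (sg : set operation) (sgM : implicit_signature sg).
Variable k : nat.
Notation window := (k.-bseq A).
Hypothesis Sk : #|S| < k.
Variable e : window -> Omega A.
Hypothesis e_sig : forall q : window, size q = k -> Omega_sig sg A (e q).
Hypothesis e_idem : forall q : window, size q = k -> e q * e q = e q.
Hypothesis e_stable : forall q : window, size q = k ->
  subst g (take (cut g q) q) * some1 (ev (e q) g) = subst g (take (cut g q) q).
Variable w : window.
Hypothesis wk : size w = k.

Notation letter := (window * A)%type.
Implicit Types (q : window) (b : letter) (u v : seq A).

(** Before k letters have been read, the window is already considered to be
    the prefix w of length k. *)
Definition node q := if size q < k then w else q.
Definition next b : window := tk k (rcons b.1 b.2).
Definition src b := node b.1.
Definition tgt b := node (next b).

(** The letters from the cut of the window to that of the next one.  Both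
    cuts are positions in the word of length k + 1 formed by the window and the
    letter; in it, the next window starts at position 1, hence the successor. *)
Definition slice b : seq A :=
  if size b.1 < k then [::]
  else drop (cut g b.1) (take (cut g (next b)).+1 (rcons b.1 b.2)).

Definition theta b : Omega A := mul_word (e (src b)) (slice b) * e (tgt b).

Definition edge b : brandt window := Some (src b, tgt b).

Lemma node_size q : size (node q) = k.
Proof.
rewrite /node; case: ltnP => // kq; apply/eqP; rewrite eqn_leq size_bseq.
exact: kq.
Qed.

Lemma theta_sig b : Omega_sig sg A (theta b).
Proof.
apply: Omega_sigM => //; last exact/e_sig/node_size.
by apply: Omega_sig_mul_word => //; exact/e_sig/node_size.
Qed.

Lemma windows_path q u : u <> [::] ->
  subst edge (windows q u)
  = some1 (Some (node q, node (tk k (q ++ u))) : brandt window).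
Proof.
elim: u q => [|a u IH] q // _; rewrite /= subst_cons.
case: u IH => [|c u] IH; first by rewrite subst_nil mulg1 cats1.
rewrite IH // tk_catl cat_rcons.
by congr Some; rewrite /mul /= /brandt_mul /edge /src /tgt /next /= eqxx.
Qed.

Section Sat.
Variables (S0 T0 : finSemigroup) (a : endo_action S0 T0).
Hypothesis DT0 : pvD T0.
Variable h : A -> finsg (semidirect a).

(** The value of [theta b] in S0, as acted upon by what the idempotent at the
    source of b leaves in T0. *)
Definition twisted b : S0 := a (ev (e (src b)) h).2 (ev (theta b) h).1.

(** In a member of D, an idempotent absorbs everything to its left. *)
Lemma absorbD q : size q = k ->
  forall y : T0, y * (ev (e q) h).2 = (ev (e q) h).2.
Proof.
move=> qk y; apply: (DT0 (x := (ev (e q) h).2)); split.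
  by rewrite -[RHS]/((ev (e q) h).2) -{3}(e_idem qk) evM.
by exists 0; rewrite expg1.
Qed.

Lemma barrier_theta q b (s : S0) : size q = k -> q = src b ->
  ((s, (ev (e q) h).2) : finsg (semidirect a)) * ev (theta b) h
  = (s * twisted b, (ev (e (tgt b)) h).2).
Proof.
move=> qk ->; congr pair; rewrite /theta evM.
rewrite -[LHS]/(((ev (e (src b)) h).2 : T0)
  * (((ev (mul_word (e (src b)) (slice b)) h).2 : T0) * (ev (e (tgt b)) h).2)).
by rewrite mulgA absorbD //; exact: node_size.
Qed.

(** After each edge, the T0-component is that of the idempotent at its
    target, which is the source of the next edge; so each factor is acted upon as
    prescribed by that edge alone. *)
Lemma path_value bs q q' : subst edge bs = some1 (Some (q, q') : brandt window) ->
  [/\ size q = k, size q' = k &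
  exists y, subst twisted bs = some1 y /\
    some1 (ev (e q) h) * subst (fun b => ev (theta b) h) bs =
    some1 ((((ev (e q) h).1 : S0) * y, (ev (e q') h).2) : finsg (semidirect a))].
Proof.
elim/last_ind: bs q q' => [|bs b IH] q q'; first by rewrite subst_nil.
rewrite !subst_rcons; case E: (subst edge bs) => [[[p p']|]|] //.
  rewrite -some1M => -[]; rewrite [_ * _]/(brandt_mul _ _) /=.
  case: eqP => // p'b [<- <-]; have [pk p'k [y [yE IHy]]] := IH _ _ E.
  split=> //; first exact: node_size.
  exists (y * twisted b); rewrite yE mulgA IHy; split=> //.
  by rewrite -some1M barrier_theta // mulgA.
have -> : bs = [::].
  by case: bs E {IH} => // c bs; have [? ->] := subst_some edge c bs.
rewrite !subst_nil mul1g => -[<- <-]; split; try exact: node_size.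
exists (twisted b); rewrite !mul1g; split=> //.
rewrite -some1M {1}[ev (e (src b)) h]surjective_pairing barrier_theta //.
exact: node_size.
Qed.

Lemma path_op (r : Omega letter) q q' : ev r edge = Some (q, q') ->
  [/\ size q = k, size q' = k &
  ev (e q * isubst r theta) h =
    (((ev (e q) h).1 : S0) * ev r twisted, (ev (e q') h).2)].
Proof.
move=> rE; have [bs []] := ev_word2 r
  (fun b => (edge b, ev (theta b) h) : brandt window * finsg (semidirect a))
  twisted.
rewrite ev_pair rE => bsE bst.
have bse : subst edge bs = some1 (Some (q, q') : brandt window).
  have := congr1 (ext1 fst) bsE; rewrite ext1_subst //.
have bsth : subst (fun b => ev (theta b) h) bs =
    some1 (ev r (fun b => ev (theta b) h)).
  have := congr1 (ext1 snd) bsE; rewrite ext1_subst //.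
have [qk q'k [y [yE E]]] := path_value bse; split=> //.
move: yE E; rewrite bst bsth -some1M => -[<-] /some1_inj E.
by rewrite evM ev_isubst.
Qed.
End Sat.

(** The value of theta r depends only on the ends of the path r and on the
    value of r in S0, a member of V. *)
Lemma theta_sat V (r r' : Omega letter) q q' :
  ev r edge = Some (q, q') -> ev r' edge = Some (q, q') -> sat V r r' ->
  sat (pv_sd V pvD) (e q * isubst r theta) (e q * isubst r' theta).
Proof.
move=> rE r'E rr'; apply: pv_sd_sat => S0 T0 a VS DT h.
have [_ _ ->] := path_op DT h rE; have [_ _ ->] := path_op DT h r'E.
by rewrite (rr' _ VS).
Qed.

(** While the window is not full, no cut is available: the substitution
    produces idempotents at the cut of w only. *)
Lemma theta_prefix q u : q ++ u = w -> forall b, b \in windows q u ->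
  ev (theta b) g = ev (e w) g.
Proof.
have nodeE (v v' : seq A) : v ++ v' = w -> node (tk k v) = w.
  move=> vw; have vk : size v <= k by rewrite -wk -vw size_cat leq_addr.
  rewrite /node; case: ltnP => //; rewrite tk_size (minn_idPl vk) => kv.
  apply: val_inj; rewrite /= -[LHS]/(tk k v : seq A) tk_id // -vw.
  have := congr1 size vw; rewrite size_cat wk => vE.
  case: v' vE {vw} => [|c v']; first by rewrite cats0.
  by move=> vE; move: kv; rewrite -vE /= addnS ltnNge leq_addr.
elim: u q => [|c u IH] q quw b //=.
have qk : size q < k.
  have le : size q + size (c :: u) = k by rewrite -size_cat quw.
  by apply: leq_trans (eq_leq le); rewrite /= addnS ltnS leq_addr.
rewrite inE => /orP[/eqP->|]; last first.
  by apply: IH; rewrite tk_id ?cat_rcons // size_rcons.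
rewrite /theta /slice /src /tgt /next /= qk.
rewrite -{1}(tk_bseq q) (nodeE q (c :: u)) // (nodeE (rcons q c) u) ?cat_rcons //.
by rewrite e_idem.
Qed.

(** By induction on v: after reading v, the substitution has produced the
    value of v up to the cut of its last window, and the idempotent inserted
    there can be removed.  The rest of the last window completes v. *)
Lemma theta_value (v : seq A) : k <= size v -> take k v = w ->
  subst g (take (cut g w) w) * some1 (ev (e w) g)
    * subst (fun b => ev (theta b) g) (windows [bseq] v)
    * subst g (drop (cut g (tk k v)) (tk k v)) = subst g v.
Proof.
move=> kv vw.
suff [c [vc ->]] : exists c, v = c ++ tk k v /\
    subst g (take (cut g w) w) * some1 (ev (e w) g)
    * subst (fun b => ev (theta b) g) (windows [bseq] v)
    = subst g (c ++ take (cut g (tk k v)) (tk k v)).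
  by rewrite -subst_cat -catA cat_take_drop -vc.
elim/last_ind: v kv vw => [|v a IH].
  by move=> /(leq_trans Sk).
rewrite size_rcons leq_eqVlt => /orP[/eqP kE|kv].
  have vE : take k (rcons v a) = rcons v a.
    by rewrite take_oversize ?size_rcons ?kE.
  rewrite vE => vw; exists [::]; rewrite vw tk_bseq; split=> //=.
  rewrite e_stable //; apply: (@subst_absorb _ _ _ _ (ev (e w) g)).
    exact: e_stable.
  exact: theta_prefix.
rewrite -cats1 takel_cat // cats1 => vw.
have [c [vc E]] := IH kv vw.
set f := tk k v in vc E.
have fk : size f = k by rewrite tk_size; apply/minn_idPr.
rewrite windows_rcons subst_rcons mulgA E -[[bseq] ++ v]/v -/f.
have [b [r fE]] : exists (b : A) (r : seq A),
    f = b :: r :> seq A.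
  have := leq_trans Sk (eq_leq (esym fk)).
  by case: (f : seq A) => [|b r] // _; exists b, r.
have rk : (size r).+1 = k by rewrite -fk fE.
set f' := tk k (rcons v a).
have f'E : f' = rcons r a :> seq A.
  rewrite /f' vc fE rcons_cat /= -cat_rcons tk_suffix ?tk_id //.
    by rewrite size_rcons rk.
  by rewrite size_rcons rk.
have r'E : rcons v a = rcons c b ++ f'.
  by rewrite f'E vc fE rcons_cat cat_rcons.
have ff' : rcons f a = b :: f' :> seq A by rewrite fE f'E.
exists (rcons c b); split=> //.
have cuts : cut g f <= (cut g f').+1.
  rewrite f'E fE; apply: cut_shift; rewrite -fE; apply: cut_le.
  by rewrite fk.
rewrite [in RHS]cat_rcons /theta evM some1M ev_mul_word /src /tgt /node.
have nf : next (f, a) = f'.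
  by rewrite /next /= /f' /f -!cats1 tk_catl.
have f'k : size f' = k by rewrite f'E size_rcons.
rewrite nf fk f'k ltnn subst_cat -!mulgA.
rewrite (mulgA (subst g (take _ _))) e_stable //.
(* in the word f a = b f', the slice leads from the cut of f to that of f' *)
have fz : take (cut g f) f ++ slice (f, a) = b :: take (cut g f') f'.
  rewrite /slice nf /= fk ltnn -/(take (cut g f').+1 (b :: f')) -ff'.
  have <- : take (cut g f) (take (cut g f').+1 (rcons f a)) = take (cut g f) f.
    rewrite take_takel // -cats1 takel_cat //.
    by apply: cut_le; rewrite fk.
  exact: cat_take_drop.
rewrite (mulgA (subst g (take _ _))) -subst_cat fz.
rewrite subst_cons -(mulgA (some1 (g b))) e_stable //.
by rewrite subst_cat subst_cons.
Qed.
End Core.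

(** * Pointlike systems *)

Lemma pointlike_mem (X : eqType) (x : X) s u v :
  (u, v) \in pointlike_system x s ->
  exists y z, [/\ u = [:: y], v = [:: z], y \in x :: s & z \in x :: s].
Proof.
elim: s x => [|y s IH] x //=; rewrite inE => /orP[/eqP[-> ->]|].
  by exists x, y; rewrite !inE !eqxx orbT.
move=> /IH[t [z [-> -> ts zs]]]; exists t, z.
by split=> //; rewrite in_cons ?ts ?zs orbT.
Qed.

Lemma pointlike_chain (X : eqType) (R : X -> X -> Prop) (x : X) s :
  (forall y, R y y) -> (forall y z t, R y z -> R z t -> R y t) ->
  (forall y z, ([:: y], [:: z]) \in pointlike_system x s -> R y z) ->
  forall y, y \in x :: s -> R x y.
Proof.
move=> Rr Rt; elim: s x => [|z s IH] x Rs y; first by rewrite inE => /eqP->.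
rewrite inE => /orP[/eqP-> //|ys].
apply: (Rt _ z); first by apply: Rs; rewrite inE eqxx.
by apply: IH ys => t t' tt'; apply: Rs; rewrite inE tt' orbT.
Qed.

(** If fewer than k letters are found, they form the whole word, in every
    approximation of p. *)
Lemma Omega_sig_short sg (A : finType) k (p : Omega A) : implicit_signature sg ->
  size (suffix_of k p) < k -> Omega_sig sg A p.
Proof.
move=> sgM fk; set f := suffix_of k p in fk.
have wordE (G : finSemigroupType) (g : A -> G) : subst g f = some1 (ev p g).
  have [w [wg _ wf]] := beta_approx p g (fun=> tt : finsg unit) (k := k).
  rewrite -wg -[f]wf tk_id //; move: fk; rewrite -[f]wf tk_size.
  by rewrite gtn_min ltnn orbF => /ltnW.
have [|q qE] := @word_ex A pvS f.
  by move=> f0; have := wordE (finsg unit) (fun=> tt); rewrite f0 subst_nil.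
apply: (Omega_sig_word sgM (w := f)); rewrite qE; congr some1.
apply: ev_inj => S g; apply: some1_inj.
by rewrite -(word_ev _ qE) wordE.
Qed.

Lemma is_delta_ev (A : Type) (S : finSemigroup) (g : A -> S) :
  is_delta g (fun p => ev p g).
Proof.
split=> [s|p q|a]; [exact: open_ev_fiber | exact: evM | exact: ev_gen].
Qed.

Lemma small_generates (A : Type) (G : finSemigroupType) (g : A -> G) :
  generates g -> generates (to_small \o g : A -> small G).
Proof.
move=> gg s; have [w wE] := gg (of_small s); exists w.
by rewrite -(ext1_subst _ _ (@to_small_hom G)) wE /= of_smallK.
Qed.

(** Reducibility in terms of operations: the solution may be required to
    preserve values in any finite semigroup, whether it is generated by the
    letters or not, by restricting to the subsemigroup that they generate. *)
Lemma lift_solution sg (V : set finSemigroup) (X B : finType) (x : X) (s : seq X)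
    (H : finSemigroupType) (h : B -> H) (p : X -> Omega B) :
  pointlike_reducible sg V -> uniq (x :: s) -> 1 <= size s ->
  (forall y, sat V (p y) (p x)) ->
  exists r : X -> Omega B, forall y,
    [/\ Omega_sig sg B (r y), ev (r y) h = ev (p y) h &
        y \in x :: s -> sat V (r x) (r y)].
Proof.
move=> hred us ss pV.
pose g' : B -> small (gensub h) := to_small \o gensub_gen h.
have gen' : generates g' by apply: small_generates; exact: gensub_generates.
have [|eta [[etaE etaV] eta_sig]] := hred X x s us ss B (small (gensub h)) g' _
    (fun y => some1 (ev (p y) g')) gen' (is_delta_ev g').
  exists (fun y => some1 (p y)); split=> // u v /pointlike_mem[y [z [-> -> _ _]]].
  rewrite !big_seq1; apply/modelsP.
  exact: sat_trans (pV y) (sat_sym (pV z)).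
have /boolp.choice[r rE] y : exists q, eta y = some1 q.
  by have := etaE y; case: (eta y) => [q|] // _; exists q.
exists r => y; split.
- exact: eta_sig (rE y).
- have := etaE y; rewrite rE => /some1_inj E.
  have := congr1 (@gensub_val _ _ h \o of_small) E.
  have cM := hom_comp (@of_small_hom _) (@gensub_val_hom _ _ h).
  rewrite !(ev_hom _ _ cM).
  have -> // : (@gensub_val _ _ h \o of_small) \o g' = h.
  by apply: funext => b; rewrite /= to_smallK.
- apply: (pointlike_chain (R := fun y z => sat V (r y) (r z))) => [t|t u v|t u tu].
  + exact: sat_refl.
  + exact: sat_trans.
  + by have := etaV _ _ tu; rewrite !big_seq1 !rE => /modelsP.
Qed.

Section Main.
Variables (V : set finSemigroup) (sg : set operation) (nu : numbering).
Hypotheses (hV : pseudovariety V) (hVLI : ~ (V `<=` pvLI)).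
Hypotheses (sgM : implicit_signature sg) (nusg : range nu = sg).
Hypothesis homega : computable_omega_words nu.
Hypothesis hred : pointlike_reducible sg V.

(** If u fixes the value of the prefix up to the cut, so does every power of
    u, hence u^w. *)
Lemma barriers (A : finType) (S : finSemigroupType) (g : A -> S) k :
  #|S| < k -> Omega A ->
  exists e : k.-bseq A -> Omega A, forall q : k.-bseq A, size q = k ->
    [/\ Omega_sig sg A (e q), e q * e q = e q &
      subst g (take (cut g q) q) * some1 (ev (e q) g) = subst g (take (cut g q) q)].
Proof.
move=> Sk p0.
suff /boolp.choice[e eP] (q : k.-bseq A) : exists e, size q = k ->
    [/\ Omega_sig sg A e, e * e = e &
      subst g (take (cut g q) q) * some1 (ev e g) = subst g (take (cut g q) q)].
  by exists e.
have [qk|] := eqVneq (size q) k; last first.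
  by move=> qk; exists p0 => /eqP; rewrite (negPf qk).
have [|u u0 ug] := @cut_period A S g q.
  by apply: leq_trans Sk (eq_leq (esym qk)).
have [e [e_sig e_idem e_pow]] := sigma_omega nusg sgM homega u0.
exists e => _; split=> //; have [n ->] := e_pow _ g.
exact: adj1_stable.
Qed.

(** All the p_y have the same last window f and the same first window w,
    so the same two words complete the theta r_y. *)
Lemma pointlike_core (A : finType) (S : finSemigroupType) (g : A -> S)
    (X : finType) (x : X) (s : seq X) (p : X -> Omega A) :
  uniq (x :: s) -> 1 <= size s ->
  (forall y, sat (pv_sd V pvD) (p y) (p x)) ->
  exists r : X -> Omega A, forall y, y \in x :: s ->
    [/\ Omega_sig sg A (r y), ev (r y) g = ev (p y) g &
        sat (pv_sd V pvD) (r x) (r y)].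
Proof.
move=> us ss psat; have [k Sk] : exists k, #|S| < k by exists #|S|.+1.
have pb y := @beta_sat A k V _ _ hV (psat y).
set f := suffix_of k (p x); have pf y : suffix_of k (p y) = f by case: (pb y).
have [fk|kf] := ltnP (size f) k.
  exists p => y _; split=> //; last exact/sat_sym/psat.
  by apply: (Omega_sig_short (k := k)) => //; rewrite pf.
have fk : size f = k by apply/eqP; rewrite eqn_leq size_bseq kf.
have [e eP] := barriers g Sk (p x).
have e_sig (q : k.-bseq A) : size q = k -> Omega_sig sg A (e q) by move=> /eP[].
have e_idem (q : k.-bseq A) : size q = k -> e q * e q = e q by move=> /eP[].
have e_stable (q : k.-bseq A) : size q = k ->
    subst g (take (cut g q) q) * some1 (ev (e q) g) = subst g (take (cut g q) q).
  by move=> /eP[].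
have [H [h [hsat hpre]]] := prefix_detect A hV hVLI (leq_ltn_trans (leq0n _) Sk).
have [wx [_ wxh wxf]] := beta_approx (p x) g h.
have long v : tk k v = f -> k <= size v.
  by move=> vf; move: kf; rewrite -vf tk_size leq_min => /andP[].
(* the prefix of length k, found in an approximation of one operation *)
pose w := tk k (take k wx).
have wE : w = take k wx :> seq A by apply: tk_id; rewrite size_takel // long.
have wk : size w = k by rewrite wE size_takel // long.
pose th := theta g e w; pose ed := edge w.
have [r rP] := lift_solution
  (fun b => (ev (th b) g, ed b) : (S * brandt (k.-bseq A))%type)
  hred us ss (fun y => (pb y).1).
have data y : ev (r y) ed = Some (w, f) /\
    subst g (take (cut g w) w) * some1 (ev (e w) g)
    * some1 (ev (r y) (fun b => ev (th b) g)) * subst g (drop (cut g f) f)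
    = some1 (ev (p y) g).
  have [_] := rP y; rewrite !ev_pair => -[-> ->] _.
  have [v [vg vh vf]] := beta_approx (p y) g
    (fun b => ((ev (th b) g, ed b), h b) : (S * brandt (k.-bseq A) * H)%type).
  rewrite pf in vf; have kv := long _ vf.
  have proj (G : finSemigroupType) (c : S * brandt (k.-bseq A) * H -> G) l :
      is_hom c -> c \o (fun b => ((ev (th b) g, ed b), h b)) = l ->
      subst l (windows [bseq] v) = some1 (ev (beta k (p y)) l).
    by move=> cM <-; rewrite -(ext1_subst _ _ cM) vh -(ev_hom _ _ cM).
  have vh3 := proj _ snd h (@hom_snd _ _) erefl.
  have vh2 := proj _ (snd \o fst) ed (hom_comp (@hom_fst _ _) (@hom_snd _ _)) erefl.
  have vh1 := proj _ (fst \o fst) (fun b => ev (th b) g)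
    (hom_comp (@hom_fst _ _) (@hom_fst _ _)) erefl.
  (* [h] makes the prefix the same for all y *)
  have vw : take k v = w.
    rewrite wE; apply: hpre; rewrite ?long // vh3 wxh; congr some1.
    exact/hsat/(pb y).1.
  have v0 : v <> [::] by move=> v0; have := leq_trans Sk kv; rewrite v0.
  split; last by rewrite -vg -(theta_value Sk e_idem e_stable wk kv vw) vf vh1.
  apply: some1_inj; rewrite -vh2 windows_path // -[[bseq] ++ v]/v vf.
  by rewrite /node fk ltnn /= (leq_ltn_trans (leq0n _) Sk).
exists (fun y => mul_word (word_mul (take (cut g w) w) (e w * isubst (r y) th))
  (drop (cut g f) f)).
move=> y ys; have [ry_sig _ /(_ ys) rV] := rP y; split.
- apply: Omega_sig_mul_word => //; apply: Omega_sig_word_mul => //.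
  apply: Omega_sigM => //.
    exact: e_sig.
  by apply: Omega_sig_isubst => // b; apply: theta_sig.
- apply: some1_inj; rewrite ev_mul_word ev_word_mul evM some1M ev_isubst mulgA.
  by case: (data y).
- have := theta_sat g e_idem wk (data x).1 (data y).1 rV.
  move=> E S0 VS0 g0; apply: some1_inj.
  by rewrite !ev_mul_word !ev_word_mul E.
Qed.

Lemma pointlike_sd : pointlike_reducible sg (pv_sd V pvD).
Proof.
move=> X x s us ss A S g delta phi gS dlt [eta [etaphi etaV]].
have etaE y : y \in x :: s -> models (pv_sd V pvD) (eta x) (eta y).
  apply: (pointlike_chain (R := fun y z => models (pv_sd V pvD) (eta y) (eta z))).
  - by [].
  - by move=> t u v; exact: etrans.
  - by move=> t u /etaV; rewrite !big_seq1.
have phi_word y : exists q, ext1 delta q = phi y /\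
    forall p, q = some1 p -> Omega_sig sg A p.
  case: (phi y) => [t|]; last by exists None.
  have [u uE] := gS t; exists (word u); split; last exact: Omega_sig_word.
  have [_ dM dg] := dlt; rewrite /word (ext1_subst _ _ dM) -[Some t]uE.
  exact: eq_subst.
have /boolp.choice[q qP] := phi_word.
(* variables that do not occur in the system are sent to words *)
have glue (r : X -> adj1 (Omega A)) :
    (forall y, y \in x :: s -> [/\ ext1 delta (r y) = phi y,
       models (pv_sd V pvD) (r x) (r y) &
       forall p, r y = some1 p -> Omega_sig sg A p]) ->
    exists eta', is_sig_solution sg (pv_sd V pvD) (pointlike_system x s)
      phi delta eta'.
  move=> rP; exists (fun y => if y \in x :: s then r y else q y); split; last first.
    by move=> y p; case: ifP => [/rP[_ _]|_]; [apply | have [_] := qP y; apply].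
  split=> [y|u v /pointlike_mem[y [z [-> -> ys zs]]]].
    by case: ifP => [/rP[] //|_]; case: (qP y).
  rewrite !big_seq1 ys zs; have [_ E _] := rP y ys; have [_ F _] := rP z zs.
  exact: etrans (esym E) F.
(* if one of the equal operations is the empty word, all of them are *)
case xE: (eta x) => [px|]; last first.
  apply: (glue (fun=> None)) => y ys; split=> //; rewrite -etaphi.
  by have := etaE y ys; rewrite xE; case: (eta y).
pose p y := if y \in x :: s then odflt px (eta y) else px.
have pE y : y \in x :: s -> eta y = some1 (p y).
  move=> ys; have := etaE y ys; rewrite /p xE ys.
  by case: (eta y).
have [|r rP] := @pointlike_core A S g X x s p us ss.
  move=> y; have [ys|ys] := boolP (y \in x :: s); last first.
    rewrite /p (negPf ys) /= mem_head xE /=; exact: sat_refl.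
  by apply/sat_sym/modelsP; rewrite -!pE ?mem_head //; exact: etaE.
apply: (glue (fun y => some1 (r y))) => y ys; have [r_sig rg rV] := rP y ys; split.
- rewrite -etaphi pE //= (delta_ev _ dlt) (delta_ev _ dlt); congr Some; exact: rg.
- exact/modelsP.
- by move=> t [<-].
Qed.
End Main.

Theorem corollary6p2 (V : set finSemigroup)
    (sg sgs : set operation) (nu nus : numbering)
    (hV : pseudovariety V) (hVLI : ~ (V `<=` pvLI))
    (hsg : highly_computable sg nu)
    (hsgs : highly_computable sgs nus)
    (hmax : sigma_maximal sg nu sgs nus)
    (homega : computable_omega_words nu)
    (htail : computable_tails nus)
    (hred : pointlike_reducible sg V) :
  pointlike_reducible sg (pv_sd V pvD).
Proof.
by have [sgM nusg _ _] := hsg; exact: pointlike_sd hV hVLI sgM nusg homega hred.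
Qed.
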